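(* Let $\tilde y\in E$ be a fixed element. Let Assumptions (A) and (B) of the context hold. Suppose that $\mathbb{E}\,d^{\theta}(\tilde y,f(\tilde y,X_0,\varepsilon_1))<\infty$ for some $0<\theta\le1$, and let $Y_{n+1}=f(Y_n,X_n,\varepsilon_{n+1})$, $n\in\mathbb{N}$, with an initialization $Y_0$ satisfying $\mathbb{E}[d(\tilde y,Y_0)^\theta]<\infty$ and independent of the process $((X_t,\varepsilon_{t+1}))_{t\ge0}$. Let $\mu$ denote the probability distribution of the pair $(X_0,Y^*_0)$, where $(Y^*_t)_{t\in\mathbb{Z}}$ is a stationary solution of the recursion (see context). 1. Under the stationary regime, $\mathbb{E}\,d^\theta(\tilde y,Y^*_0)<\infty$. 2. If $\alpha_X(n)=O(\lambda^n)$ for some $\lambda\in(0,1)$, then there exists $c>0$ such that $$d_{TV}(\mathcal{L}(X_n,Y_n),\mu)=O\left(e^{-\frac{cn}{\log(n)\log\log(n)}}\right).$$ 3. If $\alpha_X(n)=O(e^{-cn^\gamma})$ with some $c>0$ and $0<\gamma<1$, then $d_{TV}(\mathcal{L}(X_n,Y_n),\mu)=O(e^{-c'n^\gamma})$ with some $c'>0$. 4. If $\alpha_X(n)=O(n^{-\gamma})$ with some $\gamma>0$, then $$d_{TV}(\mathcal{L}(X_n,Y_n),\mu)=O\left(\frac{\log^\gamma(n)}{n^\gamma}\right).$$ 5. If $\eta$ is constant, then $d_{TV}(\mathcal{L}(X_n,Y_n),\mu)=O(e^{-cn})$ for some $c>0$, regardless of how $\alpha_X$ behaves.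
   Context: Setting. $E,F$ are Polish spaces with Borel sigma-fields $\mathcal{B}(E),\mathcal{B}(F)$; $d(\cdot,\cdot)$ denotes the metric on $E$. $X=(X_n)_{n\in\mathbb{Z}}$ is a strongly (strictly) stationary $F$-valued process. $(\varepsilon_n)$ is an i.i.d. sequence of $\mathbb{R}^d$-valued random variables ($d\ge1$ an integer), independent of $X$, indexed by $\mathbb{N}$, and extended to an i.i.d. sequence indexed by $\mathbb{Z}$ independent of $X$ when two-sided processes are considered. $f:E\times F\times\mathbb{R}^d\to E$ is measurable. Assumption (A) (contractivity modulo a constant). There exist $R>0$ and $\rho\in(0,1)$ such that $d(f(y_1,x,e),f(y_2,x,e))\le\rho\,d(y_1,y_2)+R$ for all $y_1,y_2\in E$, $x\in F$, $e\in\mathbb{R}^d$. Assumption (B) (minorization within bounded distance), with $R,\rho$ the constants of (A). Let $B_\delta(y)=\{z\in E: d(y,z)\le\delta\}$. There are a probability kernel $\nu:F\times E^2\times\mathcal{B}(E)\to[0,1]$, a measurable function $\eta:F\to(0,1]$ and a constant $K>0$ such that, for all $y_1,y_2\in E$ with $0<d(y_1,y_2)\le 2R/(1-\rho)$, all $x\in F$ and all $A\in\mathcal{B}(E)$, $\mathbb{P}(f(y_i,x,\varepsilon_0)\in A)\ge\eta(x)\nu(x,y_1,y_2,A)$ for $i=1,2$, and $\nu(x,y_1,y_2,B_K(y_i))=1$ for $i=1,2$. Stationary solution. $((X_t,Y^*_t))_{t\in\mathbb{Z}}$ is a stationary process with $Y^*_t=f(Y^*_{t-1},X_{t-1},\varepsilon_t)$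 a.s. for all $t\in\mathbb{Z}$, where for each $t$ the sequence $(\varepsilon_s)_{s>t}$ is independent of $((X_s)_{s\in\mathbb{Z}},(Y^*_s)_{s\le t})$. Under the hypotheses of the claim such a process exists and its law is unique. Notation. $\mathcal{L}(\cdot)$ is the law of a random variable. $d_{TV}$ is the total variation distance of probabilities on $\mathcal{B}(E\times F)$: $d_{TV}(\mu_1,\mu_2)=\inf_\kappa\int\mathbf{1}_{z\neq z'}\kappa(dz,dz')$ over couplings $\kappa$ of $\mu_1,\mu_2$. $\log$ is the logarithm of base $2$. For a process $Z=(Z_t)_{t\in I}$, $I=\mathbb{N}$ or $\mathbb{Z}$, the $\alpha$-mixing coefficients are $\alpha_Z(n)=\sup_{j\ge0}\sup\{|\mathbb{P}(A\cap B)-\mathbb{P}(A)\mathbb{P}(B)|: A\in\sigma(Z_s:s\le j),\ B\in\sigma(Z_s:s\ge n+j)\}$. All $O(\cdot)$ are as $n\to\infty$. *)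

(* Defs.v *)
From HB Require Import structures.
From mathcomp Require Import all_boot all_order all_algebra.
From mathcomp Require Import all_classical all_reals all_analysis.

Set Implicit Arguments.
Unset Strict Implicit.
Unset Printing Implicit Defensive.

Import Order.TTheory GRing.Theory Num.Theory.
Import numFieldNormedType.Exports.

Local Open Scope classical_set_scope.
Local Open Scope ring_scope.

(* Separable metric spaces whose measurable sets are the Borel sets; Polish
   spaces are taken with a complete metric mdist. *)
HB.mixin Record isSeparableBorel (d : measure_display) (R : realType) T
    of Measurable d T & Metric R T := {
  separable_dense : exists2 D : set T, countable D & dense D ;
  measurable_borel : @measurable d T = <<s (@open T) >> }.

#[short(type="polishType")]
HB.structure Definition Polish (d : measure_display) (R : realType) :=
  { T of Measurable d T & Metric R T & Complete T & isSeparableBorel d R T }.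

Section processes.
Context {I : Type} {Om : Type} {dT} {T : measurableType dT}.

Definition sigma_gen (J : set I) (Z : I -> Om -> T) : set (set Om) :=
  <<s \bigcup_(i in J) preimage_set_system [set: Om] (Z i) measurable >>.

End processes.

(* The product sigma-algebra on the path space I -> T. *)
Definition path_measurable (I : Type) {dT} (T : measurableType dT) :
    set (set (I -> T)) :=
  sigma_gen [set: I] (fun i (x : I -> T) => x i).

Section probability_notions.
Context {R : realType} {d} {Om : measurableType d} (P : probability Om R).

Definition independent_sigma (A B : set (set Om)) : Prop :=
  forall U V, A U -> B V -> P (U `&` V) = (P U * P V)%E.

Definition mutually_independent {I : eqType} {dT} {T : measurableType dT}
    (Z : I -> Om -> T) : Prop :=
  forall (s : seq I) (B : I -> set T), uniq s -> (forall i, measurable (B i)) ->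
    P (\bigcap_(i in [set` s]) (Z i @^-1` B i)) =
    (\prod_(i <- s) P (Z i @^-1` B i))%E.

Definition iid {I : eqType} {dT} {T : measurableType dT}
    (Z : I -> Om -> T) : Prop :=
  [/\ forall i, measurable_fun [set: Om] (Z i),
      mutually_independent Z &
      forall i j B, measurable B -> P (Z i @^-1` B) = P (Z j @^-1` B)].

(* alpha_Z(n), the suprema over j, A and B being taken at once. *)
Definition alpha_mixing {dT} {T : measurableType dT} (Z : int -> Om -> T)
    (n : nat) : R :=
  sup [set a | exists (j : nat) (A B : set Om),
    [/\ sigma_gen [set s | s <= j%:Z] Z A,
        sigma_gen [set s | (n + j)%N%:Z <= s] Z B &
        a = `|fine (P (A `&` B)) - fine (P A) * fine (P B)|]].

End probability_notions.

Definition same_law {R : realType} {I : Type} {dT} {T : measurableType dT}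
    {d} {Om : measurableType d} (P : probability Om R) (Z : I -> Om -> T)
    {d'} {Om' : measurableType d'} (P' : probability Om' R)
    (Z' : I -> Om' -> T) : Prop :=
  forall A, path_measurable A ->
    P [set w | A (fun i => Z i w)] = P' [set w | A (fun i => Z' i w)].

Definition stationary {R : realType} {dT} {T : measurableType dT}
    {d} {Om : measurableType d} (P : probability Om R)
    (Z : int -> Om -> T) : Prop :=
  forall h : int, same_law P Z P (fun t => Z (t + h)).

Section total_variation.
Context {R : realType} {dT} {T : measurableType dT}.

Definition coupling (mu1 mu2 : set T -> \bar R)
    (kappa : probability (T * T)%type R) : Prop :=
  forall A, measurable A ->
    pushforward kappa fst A = mu1 A /\ pushforward kappa snd A = mu2 A.

Definition dTV (mu1 mu2 : set T -> \bar R) : R :=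
  fine (ereal_inf [set (\int[kappa]_z ((z.1 != z.2)%:R)%:E)%E |
    kappa in [set kappa | coupling mu1 mu2 kappa]]).

End total_variation.

(* The closed ball as an inequality; [closed_ball] is the closure of the open
   ball, which may be smaller in a general metric space. *)
Definition cball {R : realType} {E : metricType R} (y : E) (k : R) : set E :=
  [set z | mdist y z <= k].

Section recursion.
Context {R : realType} {dE dF dV} {E : polishType dE R} {F : polishType dF R}
  {V : measurableType dV}.
Implicit Types f : E * F * V -> E.

(* [r] is the additive constant, usually written R; [R] is the field of reals
   here. *)
Definition contractive_modulo f (rho r : R) : Prop :=
  [/\ 0 < r, 0 < rho < 1 &
      forall y1 y2 x e,
        mdist (f (y1, x, e)) (f (y2, x, e)) <= rho * mdist y1 y2 + r].

Definition minorization {d} {Om : measurableType d} (P : probability Om R)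
    f (e0 : Om -> V) (rho r : R) (nu : R.-pker (F * (E * E)) ~> E)
    (eta : F -> R) (K : R) : Prop :=
  [/\ measurable_fun [set: F] eta, forall x, 0 < eta x <= 1, 0 < K &
      forall y1 y2, 0 < mdist y1 y2 <= 2 * r / (1 - rho) ->
      forall x y, y = y1 \/ y = y2 ->
        (forall A, measurable A ->
          ((eta x)%:E * nu (x, (y1, y2)) A
             <= P [set w | A (f (y, x, e0 w))])%E) /\
        nu (x, (y1, y2)) (cball y K) = 1%E].

Record stationary_solution {d} {Om : measurableType d} (P : probability Om R)
    f (X : int -> Om -> F) (eps : int -> Om -> V) (Y : int -> Om -> E) :
    Prop := {
  solution_measurable : forall t, measurable_fun [set: Om] (Y t) ;
  solution_stationary : stationary P (fun t w => (X t w, Y t w)) ;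
  solution_recursion : forall t,
    {ae P, forall w, Y t w = f (Y (t - 1) w, X (t - 1) w, eps t w)} ;
  solution_nonanticipative : forall t,
    independent_sigma P (sigma_gen [set s | t < s] eps)
      <<s sigma_gen [set: int] X `|` sigma_gen [set s | s <= t] Y >> }.

End recursion.

Definition log2 {R : realType} (x : R) : R := ln x / ln 2.

(* Main.v *)
Require Import Defs.
From mathcomp Require Import all_boot all_order all_algebra.
From mathcomp Require Import all_classical all_reals all_analysis.
From mathcomp Require Import measurable_realfun.
From mathcomp Require Import ring lra zify.
Import Order.TTheory GRing.Theory Num.Theory.
Import numFieldNormedType.Exports.

(** The two processes are compared with a third one, the chain started at [y0]
    in the same environment. Once a path of the environment is frozen, the
    mean of a test function with values in the unit interval after some steps
    is a function of the starting state, and the question is how fast its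
    oscillation over pairs of states at bounded distance decreases.

    Let D = 2r / (1 - rho). Two states farther apart than D are contracted by
    the factor (1 + rho) / 2, so an oscillation bound for pairs within the
    distance [radius i] holds one step earlier for pairs within [radius i.+1]
    ([osc_step_far]). For two states within D, the laws of their images have a
    common part of mass at least eta(x), which multiplies the oscillation by
    1 - eta(x), provided that the oscillation is already controlled up to the
    distance 2K + 4D ([osc_step_near], [minorized_difference]). With l such
    that [radius l] is at least 2K + 4D, this can be done every l + 1 steps: after
    j + (l + 1)N steps, starting states within [radius j] are forgotten up to
    the product of the numbers 1 - eta(x_(j + (l + 1)i)) over i < N
    ([osc_quenched]).

    The noise of a step is independent of the state and of the environment
    before it, so integrating the frozen means over the environment gives the
    means of the processes ([annealed], [forgetting]). The environments of the
    two processes have the same law, hence the chain started at [y0] has the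
    same mean for both. What remains is the probability that an initial state
    is farther than [radius j] from [y0], which is exponentially small in j
    because of the moments of order theta ([radius_tail]), and the mean u(N) of
    the product above ([fail_exp]). This bounds the difference of the two laws
    on every event, and a maximal coupling ([maximal_coupling]) turns it into a
    bound of the total variation distance by C exp(- c0 n) + 2 u(n / (2(l + 1)))
    ([dTV_comparison]).

    By stationarity u(N) does not depend on the time of the first factor, and
    by mixing u(N + g + M) <= u(N) u(M) + alpha(g) ([fail_exp_rec]), where
    u(1) < 1 since eta is positive. The rates follow from this inequality by a
    choice of the gaps g: repeated doubling for geometric mixing, with a gap
    proportional to 2^l at the l-th step, which gives even exp(- c n / log n)
    ([rate_geometric]); equal blocks and gaps for stretched exponential mixing
    ([rate_stretched]); about log n factors at mutual distance n / log n for
    polynomial mixing ([rate_polynomial]). If eta is a constant a, then u(N) is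
    the power (1 - a)^N whatever the environment ([rate_exponential]).

    The moment of the stationary solution comes from the inequality
    a_1 <= rho^theta a_0 + W between a_t = d(y0, Y*_t)^theta, where a_0 and a_1
    have the same law and W is integrable ([stationary_moment]). *)

Set Implicit Arguments.
Unset Strict Implicit.
Unset Printing Implicit Defensive.

Local Open Scope classical_set_scope.
Local Open Scope ring_scope.

(** * Bounded integrals *)
Section bounded_integrals.
Context {R : realType} {d} {T : measurableType d}.
Implicit Types (P : probability T R) (D : set T) (f g : T -> R).

Lemma measure_setT1 P : (P : {measure set T -> \bar R}) [set: T] = 1%E.
Proof. exact: probability_setT. Qed.

Lemma bounded_integrable P D f M : measurable D ->
  measurable_fun [set: T] f -> (forall x, `|f x| <= M) ->
  P.-integrable D (EFin \o f).
Proof.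
move=> mD mf fM; apply: measurable_bounded_integrable => //.
- by rewrite (le_lt_trans (probability_le1 P mD))// ltry.
- exact: measurable_funTS.
- exists M; split; first by rewrite num_real.
  by move=> x Mx t Dt /=; apply: le_trans (fM t) (ltW Mx).
Qed.

Lemma unit_norm (x : R) : 0 <= x <= 1 -> `|x| <= 1.
Proof. by move=> /andP[x0 x1]; rewrite ger0_norm. Qed.

Lemma unit_integrable P D f : measurable D ->
  measurable_fun [set: T] f -> (forall x, 0 <= f x <= 1) ->
  P.-integrable D (EFin \o f).
Proof.
by move=> mD mf f01; apply: (@bounded_integrable _ _ _ 1) => // x; exact: unit_norm.
Qed.

Lemma unit_Rintegral P f : measurable_fun [set: T] f ->
  (forall x, 0 <= f x <= 1) -> 0 <= \int[P]_x f x <= 1.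
Proof.
move=> mf f01; rewrite Rintegral_ge0 /=; last by move=> x _; case/andP: (f01 x).
have -> : (1 : R) = \int[P]_(x in setT) 1.
  by rewrite Rintegral_cst// mul1r measure_setT1.
apply: le_Rintegral => //; first exact: unit_integrable.
  by apply: (@bounded_integrable _ _ _ 1) => // x; rewrite normr1.
by move=> x _; case/andP: (f01 x).
Qed.

Lemma EFin_Rintegral P D f : P.-integrable D (EFin \o f) ->  measurable D ->
  (\int[P]_(x in D) f x)%:E = (\int[P]_(x in D) (f x)%:E)%E.
Proof. by move=> fi mD; rewrite fineK//; exact: integrable_fin_num. Qed.

End bounded_integrals.

(** * Gain of a minorized pair of images *)
Lemma ge0_integral_dominated {R : realType} {dV dE} {V : measurableType dV}
    {E : measurableType dE} (L : probability V R) (nu : probability E R)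
    (U : V -> E) (a : R) (B : set E) (G : set V) (phi : E -> R) :
  measurable_fun [set: V] U -> 0 <= a -> measurable B -> measurable G ->
  (forall A, measurable A -> (a%:E * nu A <= L (U @^-1` A))%E) ->
  nu B = 1%E -> U @^-1` B `<=` G ->
  measurable_fun [set: E] phi -> (forall y, 0 <= phi y) ->
  (a%:E * \int[nu]_y (phi y)%:E <= \int[L]_(e in G) (phi (U e))%:E)%E.
Proof.
move=> mU a0 mB mG dom nuB BG mphi phi0.
pose an : {nonneg R} := NngNum a0.
have mphiE : measurable_fun [set: E] (fun y => (phi y)%:E) by exact/measurable_EFinP.
have mUB : measurable (U @^-1` B) by rewrite -[X in measurable X]setTI; exact: mU.
have -> : (\int[nu]_y (phi y)%:E = \int[nu]_(y in B) (phi y)%:E)%E.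
  have mCB : measurable (~` B) by exact: measurableC.
  have nuCB : (nu (~` B) = 0)%E by rewrite probability_setC// nuB subee.
  rewrite -[in LHS](setvU B) ge0_integral_setU//=.
  - rewrite [X in (X + _)%E](_ : _ = 0)%E ?add0e//.
    by apply: null_set_integral => //; exact: measurable_funTS.
  - by rewrite setvU.
  - by move=> x _; rewrite lee_fin.
  - by rewrite disj_set2E setICl.
apply: (@le_trans _ _ (\int[L]_(e in U @^-1` B) (phi (U e))%:E)%E); last first.
  apply: ge0_subset_integral => //.
  - apply: measurable_funTS; apply/measurable_EFinP.
    exact: measurableT_comp.
  - by move=> x _; rewrite lee_fin.
rewrite -(@ge0_integral_pushforward _ _ _ _ _ U mU L B (fun y => (phi y)%:E))//; last first.
- by move=> y _ /=; rewrite lee_fin.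
- exact: measurable_funTS.
rewrite -(@ge0_integral_mscale _ _ _ nu B mB an (fun y => (phi y)%:E))//; last first.
- by move=> y _ /=; rewrite lee_fin.
- exact: measurable_funTS.
exact: ge0_le_measure_integral.
Qed.

Section minorized_difference.
Context {R : realType} {dV dE} {V : measurableType dV} {E : measurableType dE}.
Variables (L : probability V R) (nu : probability E R).

(** A pair of images [U1], [U2] of the noise whose laws both dominate [a * nu]
    loses the fraction [a] of the oscillation [b], without any coupling of the
    two images. On the event [G] where [U1] falls in [B1] or [U2] in [B2],
    both images lie in [Reg], where [h] stays in an interval [m, m + b];
    since [nu] is carried by [B1] and by [B2], both laws restricted to [G] still
    dominate [a * nu]. Hence, with [phi] equal to [h - m] on [Reg], the integral
    over [G] of [phi \o U2] is at least [a * \int[nu] phi], and the one of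
    [b - phi \o U1] is at least [a * (b - \int[nu] phi)]: the terms in [nu]
    cancel in the difference. Off [G] the difference is at most [b]. *)
Lemma minorized_difference (U1 U2 : V -> E) (a b : R) (B1 B2 Reg : set E)
    (h : E -> R) :
  measurable_fun [set: V] U1 -> measurable_fun [set: V] U2 ->
  0 <= a -> measurable B1 -> measurable B2 ->
  (forall A, measurable A -> (a%:E * nu A <= L (U1 @^-1` A))%E) ->
  (forall A, measurable A -> (a%:E * nu A <= L (U2 @^-1` A))%E) ->
  nu B1 = 1%E -> nu B2 = 1%E ->
  measurable_fun [set: E] h -> (forall y, 0 <= h y <= 1) ->
  (forall e, `|h (U1 e) - h (U2 e)| <= b) ->
  (forall e, B1 (U1 e) \/ B2 (U2 e) -> Reg (U1 e) /\ Reg (U2 e)) ->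
  (forall u v, Reg u -> Reg v -> `|h u - h v| <= b) ->
  \int[L]_e h (U1 e) - \int[L]_e h (U2 e) <= (1 - a) * b.
Proof.
move=> mU1 mU2 a0 mB1 mB2 dom1 dom2 nuB1 nuB2 mh h01 hb GReg hReg.
have b0 : 0 <= b by apply: le_trans (hb point).
pose G := U1 @^-1` B1 `|` U2 @^-1` B2.
have mpre (U : V -> E) B : measurable_fun [set: V] U -> measurable B -> measurable (U @^-1` B).
  by move=> mU mB; rewrite -[X in measurable X]setTI; exact: mU.
have mG : measurable G by apply: measurableU; exact: mpre.
have mCG : measurable (~` G) by exact: measurableC.
pose m := inf (h @` Reg).
have mReg u : Reg u -> m <= h u <= m + b.
  move=> Ru; have lbm : has_lbound (h @` Reg).
    by exists 0 => _ [v _ <-]; case/andP: (h01 v).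
  apply/andP; split; first by apply: ge_inf => //; exists u.
  rewrite -lerBlDr; apply: lb_le_inf; first by exists (h u), u.
  move=> _ [v Rv <-]; have := hReg _ _ Ru Rv; rewrite ler_norml; lra.
(* Clipping keeps [phi] and [b - phi] nonnegative outside [Reg] as well, so
   that both can be integrated against [nu]. *)
pose phi (u : E) : R := Num.max 0 (Num.min b (h u - m)).
have mphi : measurable_fun [set: E] phi.
  apply: measurable_maxr => //; apply: measurable_minr => //.
  exact: measurable_funB.
have phi01 u : 0 <= phi u <= b.
  by rewrite /phi le_max lexx /= ge_max b0 ge_min lexx.
have phiE u : Reg u -> phi u = h u - m.
  move=> /mReg/andP[hm hM]; rewrite /phi.
  have -> : Num.min b (h u - m) = h u - m by apply/min_idPr; lra.
  by apply/max_idPr; lra.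
have intU D (U : V -> E) (g : E -> R) (M : R) : measurable D -> measurable_fun [set: V] U ->
    measurable_fun [set: E] g -> (forall u, `|g u| <= M) ->
    L.-integrable D (EFin \o (fun e => g (U e))).
  by move=> mD mU mg gM; apply: (@bounded_integrable _ _ _ _ _ _ M) => //; exact: measurableT_comp.
have hn u : `|h u| <= 1 by exact: unit_norm.
have phin u : `|phi u| <= b by case/andP: (phi01 u) => *; rewrite ger0_norm.
have split_int (g : V -> R) (M : R) : measurable_fun [set: V] g -> (forall e, `|g e| <= M) ->
   \int[L]_e g e = \int[L]_(e in G) g e + \int[L]_(e in ~` G) g e.
  move=> mg gM; rewrite -Rintegral_setU//; first by rewrite setUv.
    by apply: (@bounded_integrable _ _ _ _ _ _ M) => //; exact: measurableU.
  by rewrite disj_set2E setICr.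
have mhU U : measurable_fun [set: V] U -> measurable_fun [set: V] (h \o U).
  by move=> mU; exact: measurableT_comp.
rewrite (split_int (fun e => h (U1 e)) 1)//; last exact: mhU.
rewrite (split_int (fun e => h (U2 e)) 1)//; last exact: mhU.
have LG1 : fine (L G) + fine (L (~` G)) = 1.
  rewrite probability_setC// fineB ?fin_num_measure//=; lra.
have offG : \int[L]_(e in ~` G) h (U1 e) - \int[L]_(e in ~` G) h (U2 e) <= b * fine (L (~` G)).
  rewrite -RintegralB//; [|exact: (intU _ _ h 1)..].
  rewrite -Rintegral_cst//; apply: le_Rintegral => //.
  - apply: (@bounded_integrable _ _ _ _ _ _ b) => //.
    by apply: measurable_funB; exact: mhU.
  - by apply: (@bounded_integrable _ _ _ _ _ _ b) => // x; rewrite ger0_norm.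
  - by move=> e _; apply: le_trans (ler_norm _) (hb e).
have onG : \int[L]_(e in G) h (U1 e) - \int[L]_(e in G) h (U2 e) =
    \int[L]_(e in G) phi (U1 e) - \int[L]_(e in G) phi (U2 e).
  rewrite -!RintegralB//; last first.
  - exact: (intU _ _ h 1).
  - exact: (intU _ _ h 1).
  - exact: (intU _ _ phi b).
  - exact: (intU _ _ phi b).
  apply: eq_Rintegral => e /set_mem /GReg[R1 R2]; rewrite !phiE//; lra.
have nuphi : nu.-integrable [set: E] (EFin \o phi).
  exact: (@bounded_integrable _ _ _ _ _ _ b).
have bphi : measurable_fun [set: E] (fun u => b - phi u) by exact: measurable_funB.
have bphin u : `|b - phi u| <= b by rewrite ler_norml; have := phi01 u; lra.
have low2 : a * \int[nu]_u phi u <= \int[L]_(e in G) phi (U2 e).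
  rewrite -lee_fin EFinM !EFin_Rintegral//; last exact: (intU _ _ _ b).
  apply: (@ge0_integral_dominated _ _ _ _ _ _ _ U2 a B2 G phi) => //.
  - by move=> e ?; right.
  - by move=> y; case/andP: (phi01 y).
have low1 : a * \int[nu]_u (b - phi u) <= \int[L]_(e in G) (b - phi (U1 e)).
  rewrite -lee_fin EFinM !EFin_Rintegral//; last 2 first.
  - exact: (intU _ _ (fun u => b - phi u) b).
  - exact: (@bounded_integrable _ _ _ _ _ _ b).
  apply: (@ge0_integral_dominated _ _ _ _ _ _ _ U1 a B1 G (fun u => b - phi u)) => //.
  - by move=> e ?; left.
  - by move=> y; have := phi01 y; lra.
rewrite RintegralB// in low1; last first.
  by apply: (@bounded_integrable _ _ _ _ _ _ b) => // x; rewrite ger0_norm.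
rewrite RintegralB// in low1; last 2 first.
- by apply: (@bounded_integrable _ _ _ _ _ _ b) => // x; rewrite ger0_norm.
- exact: (intU _ _ _ b).
rewrite !Rintegral_cst// measure_setT1 /= mulr1 in low1.
nra.
Qed.

End minorized_difference.

(** * Oscillation in a frozen environment *)
Definition osc_le {R : realType} {E : metricType R} (h : E -> R) (t b : R) :=
  forall u v, mdist u v <= t -> `|h u - h v| <= b.

Definition unit_fun {R : realType} {d} {T : measurableType d} (h : T -> R) :=
  measurable_fun [set: T] h /\ forall x, 0 <= h x <= 1.

Lemma probability_of_measure {R : realType} {d} {T : measurableType d}
    (mu : {measure set T -> \bar R}) : mu [set: T] = 1%E ->
  exists p : probability T R, forall A, p A = mu A.
Proof.
move=> mu1; exists (mnormalize mu (dirac point : probability T R)) => A.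
by rewrite /= /mnormalize /= mu1 onee_eq0 /= invr1 mule1.
Qed.

Section quenched.
Context {R : realType} {dE dF dV} {E : polishType dE R} {F : polishType dF R}
  {V : measurableType dV}.
Variables (f : E * F * V -> E) (L : probability V R).
Hypothesis mf : measurable_fun [set: _] f.

Definition step_op (x : F) (h : E -> R) (y : E) : R := \int[L]_e h (f (y, x, e)).

(** The evolution family of the inhomogeneous chain in the environment [x]:
    the mean of [g] at time [k + s], as a function of the state at time [k]. *)
Fixpoint quenched_exp (x : nat -> F) (g : E -> R) (k s : nat) : E -> R :=
  if s is s'.+1 then step_op (x k) (quenched_exp x g k.+1 s') else g.

Lemma measurable_f_noise y x : measurable_fun [set: V] (fun e => f (y, x, e)).
Proof.
apply: (measurableT_comp mf); exact: measurable_fun_pair.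
Qed.

Lemma unit_fun_integrable {dT} {T : measurableType dT} (P : probability T R)
    (h : T -> R) : unit_fun h -> P.-integrable [set: T] (EFin \o h).
Proof. by case=> mh h01; exact: unit_integrable. Qed.

Lemma unit_fun_comp {dS dT} {S : measurableType dS} {T : measurableType dT}
  (h : T -> R) (U : S -> T) : unit_fun h -> measurable_fun [set: S] U ->
  unit_fun (fun s => h (U s)).
Proof. by move=> [mh h01] mU; split=> //; exact: measurableT_comp. Qed.

Lemma step_op_unit x (h : E -> R) : unit_fun h -> unit_fun (step_op x h).
Proof.
move=> uh; split; last first.
  move=> y; have [m1 m2] := unit_fun_comp uh (measurable_f_noise y x).
  exact: unit_Rintegral.
have mh : measurable_fun [set: (E * V)%type] (fun z => (h (f (z.1, x, z.2)))%:E).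
  apply/measurable_EFinP; apply: (measurableT_comp uh.1).
  apply: (measurableT_comp mf); apply: measurable_fun_pair => //.
  exact: measurable_fun_pair.
apply: (@measurableT_comp _ _ _ _ _ _ (@fine R)) => //.
apply: (@measurable_fun_fubini_tonelli_F _ _ _ _ _ L _ mh) => z.
by rewrite lee_fin; case/andP: (uh.2 (f (z.1, x, z.2))).
Qed.

Lemma quenched_exp_unit x g k s : unit_fun g -> unit_fun (quenched_exp x g k s).
Proof.
by move=> ug; elim: s k => [|s IH] k //=; apply: step_op_unit; exact: IH.
Qed.

Variables (rho r : R).
Hypothesis contr : contractive_modulo f rho r.

Definition near_dist : R := 2 * r / (1 - rho).
(** Beyond [near_dist] one step contracts distances by the factor
    [(1 + rho) / 2], so that pairs within [radius i.+1] are sent to pairs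
    within [radius i]; the radii grow geometrically, hence leave out an
    exponentially small part of an initial law with a moment. *)
Definition radius (i : nat) : R := near_dist * (((1 + rho) / 2)^-1) ^+ i.

Let r_gt0 : 0 < r. Proof. by case: contr. Qed.
Let rho01 : 0 < rho < 1. Proof. by case: contr. Qed.
Let contrP y1 y2 x e :
  mdist (f (y1, x, e)) (f (y2, x, e)) <= rho * mdist y1 y2 + r.
Proof. by case: contr. Qed.

Lemma near_dist_gt0 : 0 < near_dist.
Proof. by rewrite /near_dist divr_gt0 ?mulr_gt0//; move: rho01; lra. Qed.

Let near_distE : r = near_dist * (1 - rho) / 2.
Proof. by rewrite /near_dist; field; move: rho01; lra. Qed.

Lemma radius0 : radius 0 = near_dist. Proof. by rewrite /radius expr0 mulr1. Qed.

Lemma radiusS i : radius i = (1 + rho) / 2 * radius i.+1.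
Proof. by rewrite /radius exprS; field; move: rho01; lra. Qed.

Lemma radius_ge i : near_dist <= radius i.
Proof.
elim: i => [|i IH]; first by rewrite radius0.
apply: (le_trans IH); have := near_dist_gt0; move: IH; rewrite radiusS.
move: rho01; nra.
Qed.

Lemma contract_radius y1 y2 x e i : mdist y1 y2 <= radius i.+1 ->
  mdist (f (y1, x, e)) (f (y2, x, e)) <= radius i.
Proof.
move=> dy; apply: le_trans (contrP _ _ _ _) _; rewrite near_distE.
have H1 : rho * mdist y1 y2 <= rho * radius i.+1.
  by rewrite ler_wpM2l//; move: rho01; lra.
have H2 : near_dist * (1 - rho) <= radius i.+1 * (1 - rho).
  by rewrite ler_wpM2r ?radius_ge//; move: rho01; lra.
rewrite radiusS; lra.
Qed.

Lemma osc_step_far x (h : E -> R) i b : unit_fun h ->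
  osc_le h (radius i) b -> osc_le (step_op x h) (radius i.+1) b.
Proof.
move=> uh hb y1 y2 dy; rewrite /step_op.
have u1 := unit_fun_comp uh (measurable_f_noise y1 x).
have u2 := unit_fun_comp uh (measurable_f_noise y2 x).
have i1 := unit_fun_integrable L u1; have i2 := unit_fun_integrable L u2.
have b0 : 0 <= b.
  apply: le_trans (hb point point _) => //; rewrite mdistxx.
  by apply: le_trans (radius_ge _); exact: ltW near_dist_gt0.
rewrite -RintegralB//.
have key e : `|h (f (y1, x, e)) - h (f (y2, x, e))| <= b.
  by apply: hb; exact: contract_radius.
have mB : measurable_fun [set: V] (fun e => h (f (y1, x, e)) - h (f (y2, x, e))).
  by apply: measurable_funB; [exact: u1.1|exact: u2.1].
apply: le_trans (le_normr_Rintegral _ _) _ => //.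
  exact: (@bounded_integrable _ _ _ _ _ _ b).
have -> : b = \int[L]_(e in setT) b by rewrite Rintegral_cst// measure_setT1 mulr1.
apply: le_Rintegral => //.
- apply: (@bounded_integrable _ _ _ _ _ _ b) => //.
    exact: measurableT_comp.
  by move=> e; rewrite normr_id.
- by apply: (@bounded_integrable _ _ _ _ _ _ b) => // e; rewrite ger0_norm.
Qed.

Lemma open_mball (y : E) (k : R) : open (ball y k).
Proof.
rewrite openE => z; rewrite ballEmdist /= => yz; rewrite /interior -nbhs_ballE.
exists (k - mdist y z) => /=; first by rewrite subr_gt0.
rewrite !ballEmdist => u /= zu; have := metric_triangle y z u; lra.
Qed.

Lemma measurable_cball (y : E) (k : R) : measurable (cball y k).
Proof.
have -> : cball y k = \bigcap_n (ball y (k + n.+1%:R^-1)).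
  apply/seteqP; split => z; rewrite /cball /=.
    by move=> zk n _; rewrite ballEmdist /= (le_lt_trans zk)// ltrDl invr_gt0.
  move=> H; apply/ler_addgt0Pr => e e0.
  have [n _ /(_ n (leqnn _)) ne] := near_infty_natSinv_lt (PosNum e0).
  by have := H n I; rewrite ballEmdist /= => /ltW/le_trans; apply; rewrite lerD2l ltW.
apply: bigcapT_measurable => n.
by rewrite measurable_borel; apply: sub_sigma_algebra; exact: open_mball.
Qed.

Variables (nu : R.-pker (F * (E * E)) ~> E) (eta : F -> R) (K : R).
Hypothesis eta01 : forall x, 0 < eta x <= 1.
Hypothesis minor : forall y1 y2, 0 < mdist y1 y2 <= near_dist ->
  forall x y, y = y1 \/ y = y2 ->
  (forall A, measurable A ->
    ((eta x)%:E * nu (x, (y1, y2)) A <= L [set e | A (f (y, x, e))])%E) /\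
  nu (x, (y1, y2)) (cball y K) = 1%E.

(** The images of two states at distance at most [near_dist] stay within
    [near_dist]. If one of them is within [K] of its origin, both are within
    [K + 2 * near_dist] of [y1], a region whose diameter must not exceed the
    distance [radius l] up to which the oscillation of [h] is known. *)
Lemma osc_step_near x (h : E -> R) l b : unit_fun h ->
  2 * K + 4 * near_dist <= radius l ->
  osc_le h (radius l) b -> osc_le (step_op x h) near_dist ((1 - eta x) * b).
Proof.
move=> uh rl hb.
have D0 := near_dist_gt0.
have b0 : 0 <= b.
  apply: le_trans (hb point point _) => //; rewrite mdistxx.
  by apply: le_trans (radius_ge _); exact: ltW near_dist_gt0.
have [e0 e1] := andP (eta01 x).
suff H y1 y2 : 0 < mdist y1 y2 <= near_dist ->
    step_op x h y1 - step_op x h y2 <= (1 - eta x) * b.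
  move=> y1 y2 dy; have [->|ny] := eqVneq y1 y2.
    by rewrite subrr normr0 mulr_ge0// subr_ge0.
  have H1 : 0 < mdist y1 y2 <= near_dist by rewrite mdist_gt0 ny.
  have H2 : 0 < mdist y2 y1 <= near_dist by rewrite metric_sym.
  by rewrite ler_norml; have := H _ _ H1; have := H _ _ H2; lra.
move=> dy; have [dom1 n1] := minor dy x (or_introl erefl).
have [dom2 n2] := minor dy x (or_intror erefl).
have dU e : mdist (f (y1, x, e)) (f (y2, x, e)) <= near_dist.
  rewrite -radius0; apply: contract_radius; apply: le_trans (radius_ge 1).
  by case/andP: dy.
have [p pE] := probability_of_measure (prob_kernel (s:=nu) (x, (y1, y2))).
apply: (@minorized_difference _ _ _ _ _ L p (fun e => f (y1, x, e)) (fun e => f (y2, x, e))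
  (eta x) b (cball y1 K) (cball y2 K) (cball y1 (K + 2 * near_dist)) h) => //.
- exact: measurable_f_noise.
- exact: measurable_f_noise.
- exact: ltW.
- exact: measurable_cball.
- exact: measurable_cball.
- by move=> A mA; rewrite pE; exact: dom1.
- by move=> A mA; rewrite pE; exact: dom2.
- by rewrite pE.
- by rewrite pE.
- exact: uh.1.
- exact: uh.2.
- move=> e; apply: hb; apply: le_trans (dU e) _; exact: radius_ge.
- move=> e; rewrite /cball /= => -[H|H].
    split; first by lra.
    have := metric_triangle y1 (f (y1, x, e)) (f (y2, x, e)); have := dU e; lra.
  have T2 := metric_triangle y1 y2 (f (y2, x, e)).
  have T1 := metric_triangle y1 (f (y2, x, e)) (f (y1, x, e)).
  rewrite (metric_sym (f (y2, x, e))) in T1.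
  by have := dU e; case/andP: dy => _ ?; split; lra.
- move=> u v; rewrite /cball /= => Hu Hv; apply: hb.
  have := metric_triangle u y1 v; rewrite (metric_sym u y1); lra.
Qed.

Lemma osc_quenched_far x g k i s b : unit_fun g ->
  osc_le (quenched_exp x g (k + i) s) near_dist b ->
  osc_le (quenched_exp x g k (i + s)) (radius i) b.
Proof.
move=> ug; elim: i k => [|i IH] k; first by rewrite addn0 add0n radius0.
rewrite addSn addnS -addSn => H /=; apply: osc_step_far.
  exact: quenched_exp_unit.
exact: IH.
Qed.

Variable l : nat.
Hypothesis rl : 2 * K + 4 * near_dist <= radius l.

(** Each attempt to merge two near states needs an oscillation bound up to
    [radius l], which [l] contracting steps provide: the attempts succeed one
    another every [l.+1] steps, at times that do not depend on the states. *)
Lemma osc_quenched_near x g k N : unit_fun g ->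
  osc_le (quenched_exp x g k (l.+1 * N)) near_dist
    (\prod_(i < N) (1 - eta (x (k + l.+1 * i)%N))).
Proof.
move=> ug; elim: N k => [|N IH] k.
  rewrite muln0 big_ord0 => u v _ /=.
  by rewrite ler_norml; have := ug.2 u; have := ug.2 v; lra.
rewrite mulnS addSn /= big_ord_recl /= muln0 addn0.
apply: (@osc_step_near _ _ l) => //; first exact: quenched_exp_unit.
apply: osc_quenched_far => //; rewrite addSnnS.
have -> : \prod_(i < N) (1 - eta (x (k + l.+1 * bump 0 i)%N)) =
  \prod_(i < N) (1 - eta (x (k + l.+1 + l.+1 * i)%N)).
  by apply: eq_bigr => i _; rewrite /bump leq0n add1n mulnS addnA.
exact: IH.
Qed.

Lemma osc_quenched x g j N : unit_fun g ->
  osc_le (quenched_exp x g 0 (j + l.+1 * N)) (radius j)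
    (\prod_(i < N) (1 - eta (x (j + l.+1 * i)%N))).
Proof.
by move=> ug; apply: osc_quenched_far => //; rewrite add0n; exact: osc_quenched_near.
Qed.

End quenched.

(** * Averaging over the environment *)
Section law.
Context {R : realType} {d dS} {Om : measurableType d} {S : measurableType dS}.
Variables (P : probability Om R) (Z : Om -> S).
Hypothesis mZ : measurable_fun [set: Om] Z.

Definition law : probability S R := distribution P (mfun_Sub (mem_set mZ)).

Lemma ge0_integral_law (h : S -> \bar R) : measurable_fun [set: S] h ->
  (forall s, 0 <= h s)%E -> (\int[law]_s h s = \int[P]_w h (Z w))%E.
Proof. by move=> mh h0; rewrite ge0_integral_distribution. Qed.

Lemma Rintegral_law (h : S -> R) : unit_fun h ->
  \int[law]_s h s = \int[P]_w h (Z w).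
Proof.
move=> [mh h01]; congr fine; rewrite ge0_integral_law//.
- exact/measurable_EFinP.
- by move=> s; rewrite lee_fin; case/andP: (h01 s).
Qed.

End law.

Section freezing.
Context {R : realType} {d dS dV} {Om : measurableType d} {S : measurableType dS}
  {V : measurableType dV}.
Variables (P : probability Om R) (L : probability V R) (Z : Om -> S) (e : Om -> V).
Hypothesis mZ : measurable_fun [set: Om] Z.
Hypothesis me : measurable_fun [set: Om] e.
Hypothesis law_e : forall B, measurable B -> P (e @^-1` B) = L B.
Hypothesis indep : forall A B, measurable A -> measurable B ->
  P (Z @^-1` A `&` e @^-1` B) = (P (Z @^-1` A) * P (e @^-1` B))%E.

(** Independence makes the joint law of [Z] and [e] a product, and Tonelli's
    theorem integrates out [e]. *)
Lemma freezing_ge0 (h : S * V -> \bar R) : measurable_fun [set: S * V] h ->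
  (forall z, 0 <= h z)%E ->
  (\int[P]_w h (Z w, e w) = \int[P]_w \int[L]_v h (Z w, v))%E.
Proof.
move=> mh h0.
have mZe : measurable_fun [set: Om] (fun w => (Z w, e w)) by exact: measurable_fun_pair.
rewrite -(ge0_integral_law P mZe)//.
transitivity (\int[law P mZ \x L]_z h z)%E.
  apply: eq_measure_integral => A mA _; apply/esym.
  apply: (@product_measure_unique _ _ _ _ _ (law P mZ) L (law P mZe)) => //.
  move=> B C mB mC; transitivity (P (Z @^-1` B `&` e @^-1` C)); first by [].
  by rewrite indep// law_e.
rewrite fubini_tonelli1// (ge0_integral_law P mZ)//.
- exact: measurable_fun_fubini_tonelli_F.
- by move=> s; apply: integral_ge0.
Qed.

Lemma freezing (h : S * V -> R) : unit_fun h ->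
  \int[P]_w h (Z w, e w) = \int[P]_w (\int[L]_v h (Z w, v)).
Proof.
move=> [mh h01]; congr fine.
rewrite (@freezing_ge0 (fun z => (h z)%:E)); last 2 first.
- exact/measurable_EFinP.
- by move=> z; rewrite lee_fin; case/andP: (h01 z).
apply: eq_integral => w _; rewrite EFin_Rintegral//.
apply: unit_integrable => //; apply: measurableT_comp mh _.
exact: measurable_fun_pair.
Qed.

End freezing.

(** The paths of the environment as a measurable type, so that functions of a
    state and of a whole path can be integrated. *)
Definition path_space {dF} (F : measurableType dF) :=
  g_sigma_algebraType (\bigcup_(i in [set: int])
    preimage_set_system [set: int -> F] (fun x => x i) measurable).

Section path_space.
Context {dF} {F : measurableType dF}.

Lemma measurable_coord (i : int) :
  measurable_fun [set: path_space F] (fun x : path_space F => x i).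
Proof.
move=> _ B mB; apply: sub_sigma_algebra; exists i => //.
by exists B.
Qed.

Lemma measurable_path {d} {Om : measurableType d} (X : int -> Om -> F) :
  (forall t, measurable_fun [set: Om] (X t)) ->
  measurable_fun [set: Om] (fun w => (fun t => X t w) : path_space F).
Proof.
move=> mX; apply: (@measurability _ _ Om (path_space F) setT _ (\bigcup_(i in [set: int])
    preimage_set_system [set: int -> F] (fun x => x i) measurable)) => //.
move=> _ [_ [i _ [B mB <-]] <-]; rewrite setTI -[X in measurable X]setTI setTI.
exact: mX.
Qed.

End path_space.

Section annealed.
Context {R : realType} {dE dF dV} {E : polishType dE R} {F : polishType dF R}
  {V : measurableType dV}.
Variables (f : E * F * V -> E) (L : probability V R).
Hypothesis mf : measurable_fun [set: _] f.
Notation W := (path_space F).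

(** The test function [G] may read the whole path: the pair formed by the
    environment and the state at a given time is a function of this kind. *)
Definition path_exp (G : E * W -> R) (k s : nat) (z : E * W) : R :=
  quenched_exp f L (fun i => z.2 i%:Z) (fun y => G (y, z.2)) k s z.1.

Lemma path_exp_unit G k s : unit_fun G -> unit_fun (path_exp G k s).
Proof.
move=> uG; elim: s k => [|s IH] k.
  by have -> : path_exp G k 0 = G by apply/funext => -[].
have [mH H01] := IH k.+1.
pose U (z : (E * W) * V) := (f (z.1.1, z.1.2 k%:Z, z.2), z.1.2).
have mU : measurable_fun [set: (E * W) * V] U.
  have m1 : measurable_fun [set: (E * W) * V] (fun z => z.1.1).
    by apply: measurableT_comp => //.
  have m2 : measurable_fun [set: (E * W) * V] (fun z => z.1.2).
    by apply: measurableT_comp => //.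
  apply: measurable_fun_pair => //; apply: (measurableT_comp mf).
  apply: measurable_fun_pair => //; apply: measurable_fun_pair => //.
  exact: (measurableT_comp (measurable_coord k%:Z) m2).
have uHU : unit_fun (fun z => path_exp G k.+1 s (U z)).
  exact: (unit_fun_comp (IH k.+1) mU).
split.
- apply: (@measurableT_comp _ _ _ _ _ _ (@fine R)) => //.
  apply: (@measurable_fun_fubini_tonelli_F _ _ _ _ _ L
    (fun z => (path_exp G k.+1 s (U z))%:E)).
    by apply/measurable_EFinP; exact: uHU.1.
  by move=> z; rewrite lee_fin; case/andP: (uHU.2 z).
- move=> z; apply: (@unit_Rintegral _ _ _ L (fun v => path_exp G k.+1 s (U (z, v)))).
    by apply: measurableT_comp uHU.1 _; exact: measurable_fun_pair.
  by move=> v; exact: (uHU.2 (z, v)).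
Qed.

Context {d} {Om : measurableType d} (P : probability Om R).
Variables (Xp : Om -> W) (Y : nat -> Om -> E) (e : nat -> Om -> V).
Hypothesis mXp : measurable_fun [set: Om] Xp.
Hypothesis mY : forall n, measurable_fun [set: Om] (Y n).
Hypothesis me : forall n, measurable_fun [set: Om] (e n).
Hypothesis rec : forall n,
  {ae P, forall w, Y n.+1 w = f (Y n w, Xp w n%:Z, e n.+1 w)}.
Hypothesis law_e : forall n B, measurable B -> P (e n @^-1` B) = L B.
Hypothesis indep : forall n (A : set (E * W)) B, measurable A -> measurable B ->
  P ((fun w => (Y n w, Xp w)) @^-1` A `&` e n.+1 @^-1` B) =
  (P ((fun w => (Y n w, Xp w)) @^-1` A) * P (e n.+1 @^-1` B))%E.

(** The noise of each step is independent of the current state and of the whole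
    environment, so that it may be integrated out with both of them frozen. *)
Lemma annealed G k s : unit_fun G ->
  \int[P]_w G (Y (k + s)%N w, Xp w) = \int[P]_w path_exp G k s (Y k w, Xp w).
Proof.
move=> uG; elim: s k => [|s IH] k; first by rewrite addn0.
rewrite -addSnnS IH.
have uH := path_exp_unit k.+1 s uG.
pose U (z : (E * W) * V) := (f (z.1.1, z.1.2 k%:Z, z.2), z.1.2).
have mU : measurable_fun [set: (E * W) * V] U.
  have m1 : measurable_fun [set: (E * W) * V] (fun z => z.1.1).
    by apply: measurableT_comp => //.
  have m2 : measurable_fun [set: (E * W) * V] (fun z => z.1.2).
    by apply: measurableT_comp => //.
  apply: measurable_fun_pair => //; apply: (measurableT_comp mf).
  apply: measurable_fun_pair => //; apply: measurable_fun_pair => //.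
  exact: (measurableT_comp (measurable_coord k%:Z) m2).
have uHU := unit_fun_comp uH mU.
have mYX n : measurable_fun [set: Om] (fun w => (Y n w, Xp w)) by exact: measurable_fun_pair.
transitivity (\int[P]_w path_exp G k.+1 s (U ((Y k w, Xp w), e k.+1 w))).
  congr fine; apply: ae_eq_integral => //.
  - by apply/measurable_EFinP; exact: (unit_fun_comp uH (mYX _)).1.
  - apply/measurable_EFinP; apply: measurableT_comp uHU.1 _.
    by apply: measurable_fun_pair.
  - move: (rec k); apply: filterS => w recw _.
    by rewrite /U /= recw.
by rewrite (freezing (mYX k) (me k.+1) (@law_e k.+1) (indep k) uHU).
Qed.

Variables (rho r : R) (nu : R.-pker (F * (E * E)) ~> E) (eta : F -> R) (K : R).
Hypothesis contr : contractive_modulo f rho r.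
Hypothesis meta : measurable_fun [set: F] eta.
Hypothesis eta01 : forall x, 0 < eta x <= 1.
Hypothesis minor : forall y1 y2, 0 < mdist y1 y2 <= near_dist rho r ->
  forall x y, y = y1 \/ y = y2 ->
  (forall A, measurable A ->
    ((eta x)%:E * nu (x, (y1, y2)) A <= L [set e | A (f (y, x, e))])%E) /\
  nu (x, (y1, y2)) (cball y K) = 1%E.
Variable l : nat.
Hypothesis rl : 2 * K + 4 * near_dist rho r <= radius rho r l.

(** The attempts take place at times [j + l.+1 * i], and an attempt in the
    environment [x] fails with probability at most [1 - eta x]. *)
Definition fail_prod (x : W) (j N : nat) : R :=
  \prod_(i < N) (1 - eta (x (j + l.+1 * i)%N%:Z)).

Lemma fail_prod_unit j N : unit_fun (fun x => fail_prod x j N).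
Proof.
split.
- apply: measurable_prod => i _; apply: measurable_funB => //.
  apply: (measurableT_comp meta); exact: measurable_coord.
- move=> x; have H (i : 'I_N) : 0 <= 1 - eta (x (j + l.+1 * i)%N%:Z) <= 1.
    by have := eta01 (x (j + l.+1 * i)%N%:Z); lra.
  rewrite /fail_prod prodr_ge0 => [|i _]; last by case/andP: (H i).
  by apply: prodr_ile1 => i _; exact: H.
Qed.

(** The process is compared with the chain started at [y0] in the same
    environment. Where the initial state is within [radius j] of [y0], the two
    means differ at most by the oscillation of the frozen evolution; elsewhere
    the trivial bound [1] is used. *)
Lemma forgetting G j N y0 : unit_fun G ->
  `|\int[P]_w G (Y (j + l.+1 * N)%N w, Xp w) -
    \int[P]_w path_exp G 0 (j + l.+1 * N) (y0, Xp w)| <=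
  fine (P [set w | radius rho r j < mdist y0 (Y 0%N w)]) +
  \int[P]_w fail_prod (Xp w) j N.
Proof.
move=> uG; have := annealed 0 (j + l.+1 * N) uG; rewrite add0n => ->.
set n := (j + l.+1 * N)%N.
have uH := path_exp_unit 0 n uG.
have u1 : unit_fun (fun w => path_exp G 0 n (Y 0%N w, Xp w)).
  by apply: (unit_fun_comp uH); exact: measurable_fun_pair.
have u2 : unit_fun (fun w => path_exp G 0 n (y0, Xp w)).
  by apply: (unit_fun_comp uH); exact: measurable_fun_pair.
have u3 := unit_fun_comp (fail_prod_unit j N) mXp.
set A := [set w | _ < _].
have mA : measurable A.
  have -> : A = Y 0%N @^-1` (~` cball y0 (radius rho r j)).
    apply/seteqP; split => w; rewrite /A /cball /=; first by rewrite ltNge => /negP.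
    by move=> /negP; rewrite -ltNge.
  rewrite -[X in measurable X]setTI; apply: mY => //.
  by apply: measurableC; exact: measurable_cball.
have u4 : unit_fun (\1_A : Om -> R).
  by split=> // w; rewrite indicE; case: (w \in A); rewrite /= ?lexx ?ler01.
rewrite -RintegralB//; [|exact: unit_fun_integrable..].
apply: le_trans (le_normr_Rintegral _ _) _ => //.
  apply: (@bounded_integrable _ _ _ _ _ _ 1) => //.
    by apply: measurable_funB; [exact: u1.1|exact: u2.1].
  by move=> w; rewrite ler_norml; have := u1.2 w; have := u2.2 w; lra.
have -> : fine (P A) = \int[P]_w (\1_A w : R).
  by rewrite /Rintegral integral_indic// setIT.
rewrite -RintegralD//; [|exact: unit_fun_integrable..].
apply: le_Rintegral => //.
- apply: (@bounded_integrable _ _ _ _ _ _ 1) => //.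
    by apply: measurableT_comp => //; apply: measurable_funB; [exact: u1.1|exact: u2.1].
  by move=> w; rewrite normr_id ler_norml; have := u1.2 w; have := u2.2 w; lra.
- apply: (@bounded_integrable _ _ _ _ _ _ 2) => //.
    by apply: measurable_funD; [exact: u4.1|exact: u3.1].
  by move=> w; rewrite ler_norml; have := u4.2 w; have := u3.2 w; lra.
move=> w _; rewrite indicE.
have [wA|wA] := boolP (w \in A).
  rewrite (_ : true%:R = 1 :> R)//.
  by rewrite ler_norml; have := u1.2 w; have := u2.2 w; have := u3.2 w; lra.
rewrite add0r /path_exp /=.
have uGw : unit_fun (fun y => G (y, Xp w)).
  by apply: (unit_fun_comp uG); exact: measurable_fun_pair.
have H := @osc_quenched _ _ _ _ _ _ _ f L mf rho r contr nu eta K eta01 minor l rl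
  (fun i => Xp w i%:Z) _ j N uGw.
apply: H.
rewrite metric_sym leNgt; apply/negP => H.
by move/negP: wA; apply; rewrite inE.
Qed.

End annealed.

(** * Total variation and maximal couplings *)
Section total_variation.
Import HBNNSimple.
Context {R : realType} {dT} {T : measurableType dT}.

(** The diagonal need not be measurable, so the integral is the supremum of
    the integrals of the simple functions below the integrand. Such a function
    is at most [1] and vanishes on the diagonal: its support is a measurable set
    that avoids the diagonal. *)
Lemma integral_offdiag_le (kappa : probability (T * T)%type R) (b : R) :
  (forall C, measurable C -> (forall x, ~ C (x, x)) -> (kappa C <= b%:E)%E) ->
  (\int[kappa]_z ((z.1 != z.2)%:R)%:E <= b%:E)%E.
Proof.
move=> kb; rewrite ge0_integralE//=.
apply: ge_ereal_sup => _ [h /= hf <-].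
pose C := [set z | h z != 0].
have mC : measurable C.
  have -> : C = ~` (h @^-1` [set 0]).
    apply/seteqP; split => z; rewrite /C /=; first by move/eqP.
    by move=> H; apply/eqP.
  by apply: measurableC; exact: measurable_sfunP.
have h1 z : h z <= \1_C z.
  have := hf z; rewrite patchE in_setT lee_fin => hz.
  rewrite indicE; have [zC|zC] := boolP (z \in C).
    by apply: le_trans hz _; case: (_ != _); rewrite ?ler01.
  by move: zC; rewrite notin_setE /C /= => /negP; rewrite negbK => /eqP ->.
rewrite -integralT_nnsfun.
apply: (@le_trans _ _ (\int[kappa]_z (\1_C z)%:E)%E).
  apply: ge0_le_integral => //.
  - by move=> z _; rewrite lee_fin.
  - exact/measurable_EFinP.
  - by apply/measurable_EFinP; exact: measurable_indic.
  - by move=> z _; rewrite lee_fin.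
rewrite integral_indic// setIT; apply: kb => // x; rewrite /C /= => /negP; apply.
have := hf (x, x); rewrite patchE in_setT /= eqxx lee_fin => hx.
by rewrite eq_le hx /=.
Qed.

(** With a Hahn decomposition of [p1 - p2] into a positive set [Pp] and a
    negative set [N], the common part of the two laws is [p1] on [N] plus [p2]
    on [Pp]; it is put on the diagonal. The excesses [pos] and [neg] have the
    same mass [delta <= b] and are coupled independently, by
    [delta^-1 * (pos \x neg)]. *)
Lemma maximal_coupling (p1 p2 : probability T R) (b : R) :
  (forall A, measurable A -> fine (p1 A) - fine (p2 A) <= b) ->
  exists2 kappa : probability (T * T)%type R, coupling p1 p2 kappa &
    (\int[kappa]_z ((z.1 != z.2)%:R)%:E <= b%:E)%E.
Proof.
move=> pb.
pose c1 := charge_of_finite_measure p1.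
pose c2 := charge_of_finite_measure p2.
pose nu : {charge set T -> \bar R} := cadd c1 (cscale (-1) c2).
have nuE A : nu A = (p1 A - p2 A)%E.
  by rewrite /nu /= /cadd /= /cscale /= mulN1e.
have [Pp [N nuPN]] := Hahn_decomposition nu.
have [[mP posP] [mN negN] PN PN0] := nuPN.
pose pos := jordan_pos nuPN; pose neg := jordan_neg nuPN.
have posE A : measurable A -> pos A = (p1 (A `&` Pp) - p2 (A `&` Pp))%E.
  by move=> mA; rewrite /pos jordan_posE charge.cjordan_posE /crestr0 mem_set//= /crestr nuE.
have negE A : measurable A -> neg A = (p2 (A `&` N) - p1 (A `&` N))%E.
  move=> mA; rewrite /neg jordan_negE charge.cjordan_negE /crestr0 mem_set//= /crestr nuE.
  by rewrite fin_num_oppeB ?fin_num_measure//; [rewrite addeC|exact: measurableI..].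
have fin1 A : measurable A -> p1 A \is a fin_num by move=> mA; exact: fin_num_measure.
have fin2 A : measurable A -> p2 A \is a fin_num by move=> mA; exact: fin_num_measure.
have split_ (p : probability T R) A : measurable A -> p A = (p (A `&` N) + p (A `&` Pp))%E.
  move=> mA; rewrite -measureU; [|exact: measurableI..|].
    by rewrite -setIUr setUC PN setIT.
  by rewrite setIACA setIid [N `&` _]setIC PN0 setI0.
have p1E A : measurable A -> p1 A = (p1 (A `&` N) + p2 (A `&` Pp) + pos A)%E.
  move=> mA; rewrite posE// (split_ p1 A mA) -addeA; congr (_ + _)%E.
  by rewrite addeC subeK// fin2//; exact: measurableI.
have p2E A : measurable A -> p2 A = (p1 (A `&` N) + p2 (A `&` Pp) + neg A)%E.
  move=> mA; rewrite negE// (split_ p2 A mA) addeAC; congr (_ + _)%E.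
  by rewrite addeC subeK// fin1//; exact: measurableI.
have finpos A : measurable A -> pos A \is a fin_num by move=> mA; exact: fin_num_measure.
have finneg A : measurable A -> neg A \is a fin_num by move=> mA; exact: fin_num_measure.
have posT : pos setT = neg setT.
  have := p1E _ measurableT; have := p2E _ measurableT.
  rewrite !measure_setT1 => ->.
  have f1 : (p1 (setT `&` N) + p2 (setT `&` Pp))%E \is a fin_num.
    by rewrite fin_numD fin1 ?fin2//; exact: measurableI.
  move: f1 (finpos _ measurableT) (finneg _ measurableT).
  move: (pos setT) (neg setT) (p1 _ + p2 _)%E => [x| |] [y| |] [c| |] // _ _ _ [].
  by move=> /addrI ->.
pose delta := fine (pos setT).
have posTE : pos setT = delta%:E by rewrite fineK// finpos.
have negTE : neg setT = delta%:E by rewrite -posT.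
have delta0 : 0 <= delta by rewrite fine_ge0.
have deltab : delta <= b.
  rewrite /delta posE// setTI fineB ?fin1 ?fin2//; exact: pb.
(* If [delta] is zero so is its inverse, and the excesses vanish. *)
have scaleE (x : \bar R) : (0 <= x <= delta%:E)%E ->
    ((delta^-1)%:E * (x * delta%:E) = x)%E.
  case/andP => x0 xd; have [d0|d0] := eqVneq delta 0.
    rewrite d0 invr0 mul0e; apply/esym/eqP; rewrite eq_le x0 andbT.
    by move: xd; rewrite d0.
  by rewrite muleC -muleA -EFinM divff// mule1.
have posle A : measurable A -> (0 <= pos A <= delta%:E)%E.
  by move=> mA; rewrite -posTE measure_ge0 /= le_measure ?inE.
have negle A : measurable A -> (0 <= neg A <= delta%:E)%E.
  by move=> mA; rewrite -negTE measure_ge0 /= le_measure ?inE.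
have rect A B : measurable A -> measurable B -> (pos \x neg)%E (A `*` B) = (pos A * neg B)%E.
  by move=> mA mB; exact: product_measure1E.
have mdiag : measurable_fun [set: T] (fun x : T => (x, x)) by exact: measurable_fun_pair.
pose invd : {nonneg R} := NngNum (etrans (invr_ge0 delta) delta0).
pose k1 : {measure set (T * T) -> \bar R} := mrestr (law p1 mdiag) (measurableX mN mN).
pose k2 : {measure set (T * T) -> \bar R} := mrestr (law p2 mdiag) (measurableX mP mP).
pose k3 : {measure set (T * T) -> \bar R} := mscale invd (pos \x neg)%E.
pose k : {measure set (T * T) -> \bar R} := measure_add (measure_add k1 k2) k3.
have kE C : k C = (p1 ([set x | C (x, x)] `&` N) + p2 ([set x | C (x, x)] `&` Pp) +
    (delta^-1)%:E * (pos \x neg) C)%E.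
  transitivity (k1 C + k2 C + k3 C)%E.
    by rewrite -measure_addE -(measure_addE (measure_add k1 k2)).
  congr (p1 _ + p2 _ + _)%E.
    by apply/seteqP; split => x /= [Cx]; [case|].
  by apply/seteqP; split => x /= [Cx]; [case|].
have k_fst A : measurable A -> k (fst @^-1` A) = p1 A.
  move=> mA; rewrite kE (_ : fst @^-1` A = A `*` setT); last first.
    by apply/seteqP; split => x //=; case.
  rewrite rect// negTE scaleE ?posle//.
  rewrite (_ : [set x | _] = A) -?p1E//.
  by apply/seteqP; split => x //=; case.
have k_snd A : measurable A -> k (snd @^-1` A) = p2 A.
  move=> mA; rewrite kE (_ : snd @^-1` A = setT `*` A); last first.
    by apply/seteqP; split => x //=; case.
  rewrite rect// posTE [(delta%:E * _)%E]muleC scaleE ?negle//.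
  rewrite (_ : [set x | _] = A) -?p2E//.
  by apply/seteqP; split => x //=; case.
have k1T : k setT = 1%E by rewrite -(preimage_setT fst) k_fst// measure_setT1.
have [kappa kappaE] := probability_of_measure k1T.
exists kappa.
  by move=> A mA; rewrite /pushforward !kappaE k_fst// k_snd.
apply: integral_offdiag_le => C mC Cd; rewrite kappaE kE.
rewrite (_ : [set x | C (x, x)] = set0); last by apply/seteqP; split => x //= /Cd.
rewrite !set0I !measure0 !add0e.
apply: (@le_trans _ _ ((delta^-1)%:E * (pos \x neg) setT)%E).
  rewrite lee_wpmul2l ?lee_fin ?invr_ge0//.
  by apply: le_measure => //; rewrite inE.
by rewrite -setXTT rect// negTE scaleE ?posle// posTE lee_fin.
Qed.

Lemma dTV_ge0 (m1 m2 : set T -> \bar R) : 0 <= dTV m1 m2.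
Proof.
rewrite fine_ge0//; apply: le_ereal_inf_tmp => _ [k _ <-].
by apply: integral_ge0 => z _; rewrite lee_fin.
Qed.

Lemma dTV_le (m1 m2 : set T -> \bar R) (p1 p2 : probability T R) (b : R) :
  (forall A, measurable A -> m1 A = p1 A) ->
  (forall A, measurable A -> m2 A = p2 A) ->
  (forall A, measurable A -> fine (p1 A) - fine (p2 A) <= b) -> dTV m1 m2 <= b.
Proof.
move=> e1 e2 pb.
have [k ck kb] := maximal_coupling pb.
have b0 : 0 <= b by have := pb _ measurable0; rewrite !measure0 /= subrr.
rewrite /dTV -lee_fin; set I := ereal_inf _.
have Ib : (I <= b%:E)%E.
  apply: le_trans kb; apply: ereal_inf_lbound; exists k => //.
  by move=> A mA; rewrite e1// e2//; exact: ck.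
have I0 : (0 <= I)%E.
  apply: le_ereal_inf_tmp => _ [k' _ <-].
  by apply: integral_ge0 => z _; rewrite lee_fin.
by rewrite fineK// ge0_fin_numE// (le_lt_trans Ib)// ltry.
Qed.

End total_variation.

(** * Covariance under alpha-mixing *)
Section layer_cake.
Context {R : realType}.

Lemma sum_lt_nat (K t : nat) : (\sum_(i < K) (i < t)%N = minn t K)%N.
Proof.
elim: K => [|K IH]; first by rewrite big_ord0 minn0.
by rewrite big_ord_recr /= IH; case: ltnP => ?; lia.
Qed.

(** If [t] is the integer part of [u * K.+1], exactly the first [t] levels are
    reached, and the proportion [t / K.+1] is a rounding of [u]. *)
Lemma staircase (K : nat) (u : R) : 0 <= u <= 1 ->
  let s := K.+1%:R^-1 * \sum_(i < K.+1) ((i.+1%:R / K.+1%:R <= u :> R)%R%:R : R) in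
  s <= u <= s + K.+1%:R^-1.
Proof.
move=> /andP[u0 u1] /=.
have K0 : 0 < K.+1%:R :> R by rewrite ltr0n.
pose x := u * K.+1%:R; have x0 : 0 <= x by rewrite mulr_ge0.
pose t := Num.truncn x.
have /andP[t1 t2] : t%:R <= x < t.+1%:R by exact: truncn_itv.
have tK : (t <= K.+1)%N.
  rewrite -(ler_nat R); apply: le_trans t1 _.
  by rewrite /x -[leRHS]mul1r ler_wpM2r// ltW.
have -> : \sum_(i < K.+1) ((i.+1%:R / K.+1%:R <= u :> R)%R%:R : R) = t%:R.
  rewrite -[in RHS](minn_idPl tK) -sum_lt_nat natr_sum; apply: eq_bigr => i _.
  congr (nat_of_bool _)%:R; rewrite ler_pdivrMr// -/x.
  apply/idP/idP => [ix|it].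
    by rewrite -ltnS -(ltr_nat R); exact: le_lt_trans ix t2.
  by apply: le_trans t1; rewrite ler_nat.
have e : u = K.+1%:R^-1 * x by rewrite /x mulrCA mulVf ?mulr1// gt_eqF.
rewrite [X in _ <= X <= _]e ler_wpM2l ?invr_ge0 ?(ltW K0)//=.
rewrite -[X in _ + X]mulr1 -mulrDr ler_pM2l ?invr_gt0//.
by rewrite -natr1 in t2; exact: ltW.
Qed.

Context {d} {Om : measurableType d} (P : probability Om R).

Lemma Rintegral_sum_ord (K : nat) (g : 'I_K -> Om -> R) :
  (forall i, unit_fun (g i)) ->
  \int[P]_w (\sum_(i < K) g i w) = \sum_(i < K) \int[P]_w g i w.
Proof.
elim: K g => [|K IH] g ug.
  rewrite big_ord0; under eq_Rintegral do rewrite big_ord0.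
  by rewrite Rintegral_cst// mul0r.
rewrite big_ord_recr /= -IH//; under eq_Rintegral do rewrite big_ord_recr /=.
rewrite RintegralD//; last exact: unit_fun_integrable.
apply: (@bounded_integrable _ _ _ _ _ _ K%:R) => //.
  by apply: measurable_sum => i; exact: (ug _).1.
move=> w; rewrite ger0_norm; last first.
  by apply: sumr_ge0 => i _; case/andP: ((ug (widen_ord (leqnSn K) i)).2 w).
apply: (@le_trans _ _ (\sum_(i < K) (1 : R))).
  by apply: ler_sum => i _; case/andP: ((ug (widen_ord (leqnSn K) i)).2 w).
by rewrite sumr_const card_ord.
Qed.

Lemma unit_fun_indic (A : set Om) : measurable A -> unit_fun (\1_A : Om -> R).
Proof.
move=> mA; split; first exact: measurable_indic.
by move=> w; rewrite indicE; case: (w \in _); rewrite /= ?lexx ?ler01.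
Qed.

Lemma unit_fun_mul (h k : Om -> R) : unit_fun h -> unit_fun k ->
  unit_fun (fun w => h w * k w).
Proof.
move=> [mh h01] [mk k01]; split; first exact: measurable_funM.
move=> w; have /andP[? ?] := h01 w; have /andP[? ?] := k01 w.
by rewrite mulr_ge0 ?mulr_ile1.
Qed.

Lemma unit_fun_cst (c : R) : 0 <= c <= 1 -> unit_fun (fun _ : Om => c).
Proof. by move=> c01; split. Qed.

Lemma Rintegral_cst1 (c : R) : \int[P]_(w in [set: Om]) c = c.
Proof. by rewrite Rintegral_cst// measure_setT1 mulr1. Qed.

Lemma Rintegral_indic (A : set Om) : measurable A ->
  \int[P]_w (\1_A w : R) = fine (P A).
Proof. by move=> mA; rewrite /Rintegral integral_indic// setIT. Qed.

Lemma le_unit_Rintegral (h k : Om -> R) : unit_fun h -> unit_fun k ->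
  (forall w, h w <= k w) -> \int[P]_w h w <= \int[P]_w k w.
Proof. by move=> uh uk hk; apply: le_Rintegral => //; exact: unit_fun_integrable. Qed.

(** A bound for all level sets of [V] passes to [V], which is a uniform limit
    of averages of indicators of its level sets. *)
Lemma layer_cake_le (g V : Om -> R) (a : R) : unit_fun g -> unit_fun V ->
  (forall t, \int[P]_w (g w * \1_[set w | t <= V w] w) <=
     (\int[P]_w g w) * fine (P [set w | t <= V w]) + a) ->
  \int[P]_w (g w * V w) <= (\int[P]_w g w) * (\int[P]_w V w) + a.
Proof.
move=> ug uV H; apply/ler_addgt0Pr => eps eps0.
have [K _ /(_ K (leqnn _)) Ke] := near_infty_natSinv_lt (PosNum eps0).
have K0 : 0 < K.+1%:R :> R by rewrite ltr0n.
pose c : R := K.+1%:R^-1.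
have c01 : 0 <= c <= 1 by rewrite invr_ge0 ltW//= invf_le1// ler1n.
pose lev (i : 'I_K.+1) : set Om := [set w | i.+1%:R / K.+1%:R <= V w].
have mlev i : measurable (lev i).
  rewrite -[lev i]setTI; apply: measurable_fun_le => //; exact: uV.1.
have u1 i := unit_fun_indic (mlev i).
pose st (h : Om -> R) w := \sum_(i < K.+1) (c * (h w * \1_(lev i) w)).
have stE h (uh : unit_fun h) :
    \int[P]_w st h w = c * \sum_(i < K.+1) \int[P]_w (h w * \1_(lev i) w).
  rewrite Rintegral_sum_ord => [|i]; last first.
    by apply: (unit_fun_mul (unit_fun_cst c01)); exact: unit_fun_mul.
  rewrite mulr_sumr; apply: eq_bigr => i _; rewrite RintegralZl//.
  by apply: unit_fun_integrable; exact: unit_fun_mul.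
have st1 w : st (fun=> 1) w <= V w <= st (fun=> 1) w + c.
  have := staircase K (uV.2 w); rewrite /= mulr_sumr => H1.
  suff -> : st (fun=> 1) w = \sum_(i < K.+1) (c * (i.+1%:R / K.+1%:R <= V w)%R%:R) by [].
  apply: eq_bigr => i _; rewrite mul1r indicE; congr (_ * (nat_of_bool _)%:R).
  by apply/idP/idP; rewrite inE.
have stg w : st g w = g w * st (fun=> 1) w.
  by rewrite mulr_sumr; apply: eq_bigr => i _; rewrite mul1r mulrCA.
have ust : unit_fun (st (fun=> 1)).
  split; last first.
    move=> w; have /andP[s1 _] := st1 w; have /andP[_ v1] := uV.2 w.
    rewrite (le_trans s1 v1) andbT; apply: sumr_ge0 => i _.
    have /andP[? _] := c01; have /andP[? _] := (u1 i).2 w.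
    by rewrite mul1r mulr_ge0.
  apply: measurable_sum => i; apply: measurable_funM => //.
  by apply: measurable_funM => //; exact: (u1 i).1.
have ustg : unit_fun (st g).
  by rewrite (_ : st g = fun w => g w * st (fun=> 1) w); [exact: unit_fun_mul|exact/funext].
have EV : c * \sum_(i < K.+1) fine (P (lev i)) <= \int[P]_w V w.
  have -> : \sum_(i < K.+1) fine (P (lev i)) = \sum_(i < K.+1) \int[P]_w (1 * \1_(lev i) w).
    apply: eq_bigr => i _; under [RHS]eq_Rintegral do rewrite mul1r.
    by rewrite Rintegral_indic.
  rewrite -stE; last by apply: unit_fun_cst; rewrite ler01 lexx.
  by apply: le_unit_Rintegral => // w; case/andP: (st1 w).
have EgV : \int[P]_w (g w * V w) <= \int[P]_w st g w + c.
  rewrite -[X in _ + X]Rintegral_cst1 -RintegralD//; last 2 first.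
  - exact: unit_fun_integrable.
  - by apply: unit_fun_integrable; exact: unit_fun_cst.
  apply: le_Rintegral => //.
  - by apply: unit_fun_integrable; exact: unit_fun_mul.
  - apply: (@bounded_integrable _ _ _ _ _ _ 2) => //.
      by apply: measurable_funD => //; exact: ustg.1.
    by move=> w; have := ustg.2 w; rewrite ler_norml; lra.
  move=> w _; rewrite stg; have /andP[g0 g1] := ug.2 w; have /andP[s1 s2] := st1 w.
  have : g w * V w <= g w * (st (fun=> 1) w + c) by rewrite ler_wpM2l.
  have : g w * c <= 1 * c by rewrite ler_wpM2r//; case/andP: c01.
  rewrite mulrDr; lra.
have /andP[Eg0 Eg1] := unit_Rintegral P ug.1 ug.2.
have Esum : \int[P]_w st g w <= (\int[P]_w g w) * (c * \sum_(i < K.+1) fine (P (lev i))) + a.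
  rewrite stE// mulrCA !mulr_sumr.
  have -> : a = \sum_(i < K.+1) (c * a).
    by rewrite sumr_const card_ord -[RHS]mulr_natl mulrA divff ?mul1r// gt_eqF.
  rewrite -big_split /=; apply: ler_sum => i _.
  rewrite -mulrDr; apply: ler_wpM2l; first by case/andP: c01.
  exact: H.
have := ler_wpM2l Eg0 EV; have : c < eps by []; lra.
Qed.

End layer_cake.

Section mixing.
Context {R : realType} {d dF} {Om : measurableType d} {F : measurableType dF}.
Variables (P : probability Om R) (X : int -> Om -> F).
Hypothesis mX : forall t, measurable_fun [set: Om] (X t).

Lemma sigma_gen_measurable (J : set int) A : sigma_gen J X A -> measurable A.
Proof.
apply: smallest_sub; first exact: sigma_algebra_measurable.
by move=> _ [i _ [B mB <-]]; exact: mX.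
Qed.

Lemma alpha_mixing_ub (j n : nat) A B :
  sigma_gen [set s | s <= j%:Z] X A ->
  sigma_gen [set s | (n + j)%N%:Z <= s] X B ->
  `|fine (P (A `&` B)) - fine (P A) * fine (P B)| <= alpha_mixing P X n.
Proof.
move=> sA sB; apply: ub_le_sup; last by exists j, A, B.
have P01 C : measurable C -> 0 <= fine (P C) <= 1.
  move=> mC; rewrite fine_ge0//= -lee_fin fineK ?fin_num_measure//.
  exact: probability_le1.
exists 1 => _ [j' [A' [B' [/sigma_gen_measurable mA /sigma_gen_measurable mB ->]]]].
have /andP[? ?] := P01 _ (measurableI _ _ mA mB).
have /andP[a0 a1] := P01 _ mA; have /andP[b0 b1] := P01 _ mB.
have := mulr_ge0 a0 b0; have := mulr_ile1 a0 b0 a1 b1.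
by rewrite ler_norml; lra.
Qed.

(** The mixing coefficient controls events; the layer-cake bound is used once
    for [V] and once for [U]. *)
Lemma covariance_le_alpha (j n : nat) (U V : Om -> R) :
  unit_fun U -> unit_fun V ->
  (forall t, sigma_gen [set s | s <= j%:Z] X [set w | t <= U w]) ->
  (forall t, sigma_gen [set s | (n + j)%N%:Z <= s] X [set w | t <= V w]) ->
  \int[P]_w (U w * V w) <=
    (\int[P]_w U w) * (\int[P]_w V w) + alpha_mixing P X n.
Proof.
move=> uU uV sU sV.
apply: layer_cake_le => // t.
have mB := sigma_gen_measurable (sV t).
rewrite -Rintegral_indic//.
under eq_Rintegral do rewrite mulrC; rewrite [X in _ <= X + _]mulrC.
apply: layer_cake_le => //; first exact: unit_fun_indic.
move=> s; have mA := sigma_gen_measurable (sU s).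
rewrite Rintegral_indic//.
have -> : \int[P]_w (\1_[set w0 | t <= V w0] w * \1_[set w0 | s <= U w0] w) =
    fine (P ([set w | s <= U w] `&` [set w | t <= V w])).
  rewrite -Rintegral_indic; last exact: measurableI.
  by apply: eq_Rintegral => w _; rewrite indicI mulrC.
have := alpha_mixing_ub (sU s) (sV t); rewrite ler_norml; lra.
Qed.

Lemma alpha_mixing_ge0 n : 0 <= alpha_mixing P X n.
Proof.
have := @alpha_mixing_ub 0 n set0 set0; rewrite setI0 measure0 /= mul0r subrr normr0.
by apply; exact: sigma_algebra0.
Qed.

End mixing.

(** * The failure sequence *)
Lemma same_law_Rintegral {R : realType} {dF d d'} {F : measurableType dF}
    {Om : measurableType d} {Om' : measurableType d'}
    (P : probability Om R) (P' : probability Om' R)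
    (X : int -> Om -> F) (X' : int -> Om' -> F) (h : path_space F -> R) :
  (forall t, measurable_fun [set: Om] (X t)) ->
  (forall t, measurable_fun [set: Om'] (X' t)) ->
  same_law P X P' X' -> unit_fun h ->
  \int[P]_w h (fun t => X t w) = \int[P']_w h (fun t => X' t w).
Proof.
move=> mX mX' XX' uh.
rewrite -(Rintegral_law P (measurable_path mX) uh).
rewrite -(Rintegral_law P' (measurable_path mX') uh).
by congr fine; apply: eq_measure_integral => A mA _; exact: XX'.
Qed.

Section failure_probability.
Context {R : realType} {d dF} {Om : measurableType d} {F : polishType dF R}.
Variables (P : probability Om R) (X : int -> Om -> F).
Hypothesis mX : forall t, measurable_fun [set: Om] (X t).
Hypothesis statX : stationary P X.
Variables (eta : F -> R) (l : nat).
Hypothesis meta : measurable_fun [set: F] eta.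
Hypothesis eta01 : forall x, 0 < eta x <= 1.

Let Xp w : path_space F := fun t => X t w.

Definition fail_exp (N : nat) : R := \int[P]_w fail_prod eta l (Xp w) 0 N.

Lemma fail_level (J : set int) (j N : nat) (t : R) :
  (forall i, (i < N)%N -> J (j + l.+1 * i)%N%:Z) ->
  sigma_gen J X [set w | t <= fail_prod eta l (Xp w) j N].
Proof.
move=> JN.
pose G := \bigcup_(i in J) preimage_set_system [set: Om] (X i) measurable.
have mXJ i : J i -> measurable_fun [set: g_sigma_algebraType G] (X i : g_sigma_algebraType G -> F).
  by move=> Ji _ B mB; apply: sub_sigma_algebra; exists i => //; exists B.
have mU : measurable_fun [set: g_sigma_algebraType G]
    (fun w : g_sigma_algebraType G => fail_prod eta l (Xp w) j N).
  pose h (i : nat) (w : g_sigma_algebraType G) : R :=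
    if (i < N)%N then 1 - eta (X (j + l.+1 * i)%N%:Z w) else 1.
  have -> : (fun w : g_sigma_algebraType G => fail_prod eta l (Xp w) j N) =
     (fun w => \prod_(i < N) h i w).
    by apply/funext => w; apply: eq_bigr => i _; rewrite /h ltn_ord.
  apply: measurable_prod => i _; rewrite /h ltn_ord.
  apply: measurable_funB => //; apply: (measurableT_comp meta).
  by apply: mXJ; exact: JN.
have := mU measurableT _ (measurable_itv `[t, +oo[); rewrite setTI.
rewrite (_ : _ @^-1` _ = [set w | t <= fail_prod eta l (Xp w) j N])//.
by apply/seteqP; split => w /=; rewrite in_itv /= andbT.
Qed.

Lemma fail_shift j N :
  \int[P]_w fail_prod eta l (Xp w) j N = fail_exp N.
Proof.
have mXs t : measurable_fun [set: Om] (X (t + j%:Z)) by exact: mX.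
have := same_law_Rintegral mX mXs (statX j%:Z) (fail_prod_unit meta eta01 l 0 N).
rewrite /fail_exp => ->; apply: eq_Rintegral => w _.
apply: eq_bigr => i _; congr (1 - eta (X _ w)).
by rewrite add0n PoszD addrC.
Qed.

Lemma fail_Xp_unit j N : unit_fun (fun w => fail_prod eta l (Xp w) j N).
Proof. exact: (unit_fun_comp (fail_prod_unit meta eta01 l j N) (measurable_path mX)). Qed.

Lemma fail_prodD x j N M : fail_prod eta l x j (N + M) =
  fail_prod eta l x j N * fail_prod eta l x (j + l.+1 * N) M.
Proof.
rewrite /fail_prod big_split_ord /=; congr (_ * _).
by apply: eq_bigr => i _; rewrite mulnDr addnA.
Qed.

(** Among [N + g + M] factors, the [g] middle ones are bounded by [1]. The
    first [N] and the last [M] are then at least [g] time steps apart, and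
    stationarity identifies the mean of the last ones with [fail_exp M]. *)
Lemma fail_exp_rec N g M :
  fail_exp (N + g + M) <= fail_exp N * fail_exp M + alpha_mixing P X g.
Proof.
rewrite -(fail_shift (l.+1 * (N + g)) M).
apply: le_trans (@covariance_le_alpha _ _ _ _ _ _ _ mX (l.+1 * N) g _ _
   (fail_Xp_unit 0 N) (fail_Xp_unit (l.+1 * (N + g)) M) _ _).
- apply: le_unit_Rintegral.
  + exact: fail_Xp_unit.
  + by apply: unit_fun_mul; exact: fail_Xp_unit.
  + move=> w; rewrite 2!fail_prodD add0n.
    have /andP[a0 a1] := (fail_Xp_unit 0 N).2 w.
    have /andP[b0 b1] := (fail_Xp_unit (l.+1 * N) g).2 w.
    have /andP[c0 c1] := (fail_Xp_unit (l.+1 * (N + g)) M).2 w.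
    by rewrite ler_wpM2r// ler_piMr.
- move=> t; apply: fail_level => i iN /=; rewrite add0n lez_nat.
  by rewrite leq_mul2l ltnW ?orbT.
- move=> t; apply: fail_level => i iM /=; rewrite lez_nat.
  rewrite mulnDr -addnA addnC leq_add2l mulSn -addnA; exact: leq_addr.
Qed.

Lemma fail_exp_ge0 N : 0 <= fail_exp N.
Proof. by case/andP: (unit_Rintegral P (fail_Xp_unit 0 N).1 (fail_Xp_unit 0 N).2). Qed.

Lemma fail_exp_le1 N : fail_exp N <= 1.
Proof. by case/andP: (unit_Rintegral P (fail_Xp_unit 0 N).1 (fail_Xp_unit 0 N).2). Qed.

Lemma fail_exp_decr N M : (N <= M)%N -> fail_exp M <= fail_exp N.
Proof.
move=> NM; rewrite -(subnKC NM).
apply: le_unit_Rintegral; [exact: fail_Xp_unit..|].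
move=> w; rewrite fail_prodD.
have /andP[a0 a1] := (fail_Xp_unit 0 N).2 w.
have /andP[b0 b1] := (fail_Xp_unit (0 + l.+1 * N) (M - N)).2 w.
by rewrite ler_piMr.
Qed.

(** The mean of [eta (X 0)] is positive because [eta] is positive everywhere. *)
Lemma fail_exp1 : fail_exp 1 < 1.
Proof.
have ue : unit_fun (fun w => eta (X 0 w)).
  split; first by apply: (measurableT_comp meta); exact: mX.
  by move=> w; have := eta01 (X 0 w); lra.
have -> : fail_exp 1 = 1 - \int[P]_w eta (X 0 w).
  rewrite -[X in X - _](Rintegral_cst1 P) -RintegralB//.
  - apply: eq_Rintegral => w _; rewrite /fail_prod big_ord_recl big_ord0 mulr1.
    by rewrite muln0.
  - by apply: unit_fun_integrable; apply: unit_fun_cst; rewrite ler01 lexx.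
  - exact: unit_fun_integrable.
rewrite ltrBlDr ltrDl lt_neqAle; apply/andP; split; last first.
  by apply: Rintegral_ge0 => w _; case/andP: (ue.2 w).
apply/eqP => /esym e0.
have i0 : (\int[P]_w `|(eta (X 0 w))%:E| = 0)%E.
  rewrite -[RHS]/(0%:E) -e0 EFin_Rintegral//; last exact: unit_fun_integrable.
  by apply: eq_integral => w _; rewrite gee0_abs// lee_fin; case/andP: (ue.2 w).
have me : measurable_fun [set: Om] (fun w => (eta (X 0 w))%:E).
  by apply/measurable_EFinP; exact: ue.1.
have [N [mN N0 subN]] := (ae_eq_integral_abs P measurableT me).1 i0.
have : P [set: Om] = 0%E.
  apply: subset_measure0 N0 => // w _; apply: subN => /= H.
  have := H I; case => ew; have := eta01 (X 0 w); rewrite ew; lra.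
by rewrite probability_setT => /eqP; rewrite onee_eq0.
Qed.

End failure_probability.

(** * Rates from the failure inequality *)
Section bigO_nat.
Context {R : realType}.
Implicit Types f g : nat -> R.

Lemma bigO_ex f g : f =O_\oo g ->
  exists C n1, 0 < C /\ forall n, (n1 <= n)%N -> `|f n| <= C * `|g n|.
Proof.
move=> /eqO_exP[C C0 [n1 _ H]]; by exists C, n1; split=> // n nn; exact: H.
Qed.

Lemma bigO_intro f g C n1 :
  (forall n, (n1 <= n)%N -> `|f n| <= C * `|g n|) -> f =O_\oo g.
Proof.
move=> H; apply/eqO_exP; exists (Num.max 1 C); first by rewrite lt_max ltr01.
exists n1 => // n /= nn; apply: le_trans (H n nn) _.
by rewrite ler_wpM2r// le_max lexx orbT.
Qed.

End bigO_nat.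

Lemma bracket (g : nat -> nat) (n : nat) : (g 0 <= n)%N -> (forall i, (i <= g i)%N) ->
  exists i, (g i <= n < g i.+1)%N.
Proof.
move=> g0 gi.
have ex : exists i, (g i <= n)%N by exists 0%N.
have ub i : (g i <= n)%N -> (i <= n)%N by exact: leq_trans.
case: (ex_maxnP ex ub) => i gin imax; exists i; rewrite gin /= ltnNge.
by apply/negP => /imax; rewrite ltnn.
Qed.

Section rates.
Context {R : realType}.

Lemma exp_quad (x : R) : 0 <= x -> x ^+ 2 / 4 <= expR x.
Proof.
move=> x0; have -> : expR x = expR (x / 2) ^+ 2.
  by rewrite -expRM_natl; congr expR; rewrite -mulr_natl; field.
have := expR_ge1Dx (x / 2) => h.
have : (x / 2) ^+ 2 <= expR (x / 2) ^+ 2 by rewrite lerXn2r ?nnegrE ?divr_ge0// ?expR_ge0//; lra.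
by apply: le_trans; rewrite expr_div_n -natrX.
Qed.

Lemma nat_above (x : R) : exists n : nat, x <= n%:R.
Proof.
exists (Num.truncn `|x|).+1; apply: (le_trans (ler_norm x)).
by have /andP[_ /ltW] := truncn_itv (normr_ge0 x).
Qed.

Lemma log_small (Q : R) : exists n0 : nat, forall n, (n0 <= n)%N ->
  Q * ln n%:R <= n%:R.
Proof.
pose Q' := Num.max 1 Q; have Q1 : 1 <= Q' by rewrite le_max lexx.
have [n0 n0P] := nat_above (expR (4 * Q')).
exists n0 => n nn.
have n1 : expR (4 * Q') <= n%:R by apply: le_trans n0P _; rewrite ler_nat.
have npos : 0 < n%:R :> R by apply: lt_le_trans n1; exact: expR_gt0.
have x4 : 4 * Q' <= ln n%:R by rewrite -ler_expR lnK.
have x0 : 0 <= ln n%:R :> R by lra.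
have := exp_quad x0; rewrite lnK// => H; apply: le_trans H.
have : Q <= Q' by rewrite le_max lexx orbT.
nra.
Qed.

Lemma ln_large (Q : R) : exists n0 : nat, forall n, (n0 <= n)%N -> Q <= ln n%:R :> R.
Proof.
have [n0 n0P] := nat_above (expR Q); exists n0 => n nn.
have n1 : expR Q <= n%:R by apply: le_trans n0P _; rewrite ler_nat.
by rewrite -ler_expR lnK// posrE (lt_le_trans (expR_gt0 _) n1).
Qed.

Lemma exprn_small (a eps : R) : 0 <= a < 1 -> 0 < eps -> exists k : nat, a ^+ k <= eps.
Proof.
move=> /andP[a0 a1] e0.
have [->|an0] := eqVneq a 0; first by exists 1%N; rewrite expr1 ltW.
have ap : 0 < a by rewrite lt_neqAle eq_sym an0.
have la : ln a < 0 by rewrite ln_lt0// ap a1.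
have [k kP] := nat_above (ln eps / ln a).
exists k; rewrite -ler_ln ?posrE ?exprn_gt0// lnXn// -mulr_natl.
by rewrite -ler_ndivrMr.
Qed.

(** A nonincreasing sequence [u] with values in the unit interval that is
    submultiplicative up to the error [alpha] of a gap. How fast it decreases is
    decided by the choice of the gaps. *)
Variables (u alpha : nat -> R).
Hypothesis u_ge0 : forall n, 0 <= u n.
Hypothesis u_decr : forall n m, (n <= m)%N -> u m <= u n.
Hypothesis u_rec : forall N g M, u (N + g + M) <= u N * u M + alpha g.
Hypothesis u_le1 : forall n, u n <= 1.
Hypothesis u1 : u 1 < 1.

Hypothesis alpha_ge0 : forall n, 0 <= alpha n.

(** Single factors, each separated from the next by a gap [p]; the errors
    form a geometric series. *)
Lemma u_spaced a k p : u 1 <= a -> a < 1 -> u (k * p.+1) <= a ^+ k + alpha p / (1 - a).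
Proof.
move=> ua a1; have a0 := le_trans (u_ge0 1) ua.
have al0 : 0 <= alpha p / (1 - a) by rewrite divr_ge0// subr_ge0 ltW.
elim: k => [|k IH]; first by rewrite mul0n expr0; have := u_le1 0; lra.
have -> : (k.+1 * p.+1 = 1 + p + k * p.+1)%N by rewrite mulSn add1n.
apply: le_trans (u_rec _ _ _) _.
have H1 : u 1 * u (k * p.+1) <= a * (a ^+ k + alpha p / (1 - a)).
  by apply: ler_pM.
have H2 : alpha p = alpha p / (1 - a) * (1 - a) by rewrite divfK// subr_eq0 gt_eqF.
rewrite exprS; move: H1; rewrite mulrDr [X in _ -> _ + X <= _]H2 => H1.
apply: (le_trans (lerD H1 (lexx _))); nra.
Qed.

Lemma u_small : (forall e, 0 < e -> exists p, alpha p <= e) ->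
  forall e, 0 < e -> exists N0, forall N, (N0 <= N)%N -> u N <= e.
Proof.
move=> asmall e e0.
have d0 : 0 < 1 - u 1 by rewrite subr_gt0.
have [p pP] := asmall (e / 2 * (1 - u 1)) (mulr_gt0 (divr_gt0 e0 (ltr0n _ 2)) d0).
have u01 : 0 <= u 1 < 1 by rewrite u_ge0.
have [k kP] := exprn_small u01 (divr_gt0 e0 (ltr0n _ 2)).
exists (k * p.+1)%N => N /u_decr uN; apply: (le_trans uN).
apply: (le_trans (u_spaced k p (lexx _) u1)).
have : alpha p / (1 - u 1) <= e / 2 by rewrite ler_pdivrMr.
lra.
Qed.

(** Doubling: level [l] consists of two copies of level [l - 1] separated by a
    gap proportional to [2 ^ l], for which the error is as small as the square
    of the preceding bound. The gaps add up to [A * l * 2 ^ l], whence a loss of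
    a logarithm only. *)
Lemma u_geometric (lambda C : R) (n1 : nat) : 0 < lambda < 1 ->
  (forall n, (n1 <= n)%N -> alpha n <= C * lambda ^+ n) ->
  exists A N0, (0 < N0)%N /\ forall l, u (2 ^ l * (N0 + A * l)) <= 2^-1 ^+ (2 ^ l).
Proof.
move=> /andP[l0 l1] H.
pose C' := Num.max 1 C; have C1 : 1 <= C' by rewrite le_max lexx.
have Cpos : 0 < C' by lra.
have l01 : 0 <= lambda < 1 by rewrite ltW.
have lle : 0 <= lambda <= 1 by rewrite !ltW.
have H' n : (n1 <= n)%N -> alpha n <= C' * lambda ^+ n.
  move=> /H aH; apply: (le_trans aH); rewrite ler_wpM2r ?exprn_ge0 ?(ltW l0)//.
  by rewrite le_max lexx orbT.
have pick e : 0 < e -> exists p, (n1 <= p)%N /\ C' * lambda ^+ p <= e.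
  move=> e0; have [p pP] := exprn_small l01 (divr_gt0 e0 Cpos).
  exists (maxn n1 p); split; first exact: leq_maxl.
  rewrite mulrC -ler_pdivlMr//; apply: le_trans pP.
  by apply: ler_wiXn2l; [exact: ltW|exact: ltW|exact: leq_maxr].
have asmall e : 0 < e -> exists p, alpha p <= e.
  by move=> /pick[p [np pe]]; exists p; exact: le_trans (H' _ np) pe.
have q0 : 0 < 2^-1 :> R by rewrite invr_gt0.
have q1 : 2^-1 <= 1 :> R by lra.
have [N0 N0P] := u_small asmall (exprn_gt0 2 q0).
have [A [nA AP]] := pick _ (exprn_gt0 4 q0).
exists A, N0.+1; split=> // l.
(* The additional factor 1/2 leaves room for the sum of the two terms of the
   inequality. *)
suff : u (2 ^ l * (N0.+1 + A * l)) <= 2^-1 ^+ (2 ^ l).+1.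
  move/le_trans; apply; rewrite exprS ler_piMl// exprn_ge0// ltW.
elim: l => [|l IH].
  by rewrite expn0 mul1n muln0 addn0; apply: N0P.
set X := (2 ^ l * (N0.+1 + A * l))%N in IH.
have -> : (2 ^ l.+1 * (N0.+1 + A * l.+1) = X + A * 2 ^ l.+1 + X)%N.
  by rewrite /X expnS; ring.
apply: (le_trans (u_rec _ _ _)).
set t := (2 ^ l.+1)%N; have t0 : (0 < t)%N by rewrite expn_gt0.
have tl : t = (2 ^ l + 2 ^ l)%N by rewrite /t expnS mul2n addnn.
have al : alpha (A * t) <= 2^-1 ^+ (t.+2).
  have nAt : (n1 <= A * t)%N by apply: (leq_trans nA); exact: leq_pmulr.
  apply: (le_trans (H' _ nAt)); rewrite exprM.
  apply: (@le_trans _ _ ((C' * lambda ^+ A) ^+ t)).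
    rewrite exprMn ler_wpM2r ?exprn_ge0 ?(ltW l0)//.
    by apply: ler_eXnr.
  apply: (@le_trans _ _ ((2^-1 ^+ 4) ^+ t)).
    by apply: lerXn2r => //; rewrite nnegrE ?mulr_ge0 ?exprn_ge0 ?(ltW l0) ?(ltW q0) ?(ltW Cpos).
  have t4 : (t.+2 <= 4 * t)%N by clear -t0; move: (t) t0 => s; lia.
  by rewrite -exprM; apply: ler_wiXn2l; rewrite ?(ltW q0).
have uX : u X * u X <= 2^-1 ^+ (t.+2).
  apply: (@le_trans _ _ (2^-1 ^+ (2 ^ l).+1 * 2^-1 ^+ (2 ^ l).+1)).
    by apply: ler_pM.
  by rewrite -exprD tl addSn addnS.
apply: (le_trans (lerD uX al)).
by rewrite [2^-1 ^+ t.+2]exprS; lra.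
Qed.

Lemma rate_geometric (lambda C : R) (n1 b : nat) : 0 < lambda < 1 -> (0 < b)%N ->
  (forall n, (n1 <= n)%N -> alpha n <= C * lambda ^+ n) ->
  exists c n0, 0 < c /\ forall n, (n0 <= n)%N ->
    u (n %/ b) <= expR (- (c * n%:R / log2 n%:R)).
Proof.
move=> l01 b0 /(u_geometric l01)[A [N0 [N00 H]]].
have ln2 : 0 < ln 2 :> R by rewrite ln_gt0// ltr1n.
pose B := (N0 + A)%N; have B0 : (0 < B)%N by rewrite addn_gt0 N00.
have K0 : 0 < (4 * b * B)%N%:R :> R by rewrite ltr0n !muln_gt0 b0 B0.
exists (ln 2 / (4 * b * B)%N%:R), (b * N0 + 2)%N; split; first by rewrite divr_gt0.
move=> n nn.
pose g l := (b * (2 ^ l * (N0 + A * l)))%N.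
have g0 : (g 0 <= n)%N by rewrite /g expn0 mul1n muln0 addn0; apply: leq_trans nn; rewrite leq_addr.
have ge2 i : (2 ^ i <= g i)%N.
  rewrite /g -{1}[(2 ^ i)%N]mul1n leq_mul// leq_pmulr// addn_gt0 N00//.
have gi i : (i <= g i)%N by apply: leq_trans (ge2 i); apply: ltnW; exact: ltn_expl.
have [l /andP[gl gl1]] := bracket g0 gi.
have ul : u (n %/ b) <= 2^-1 ^+ (2 ^ l).
  by apply: le_trans (H l); apply: u_decr; rewrite leq_divRL// mulnC.
apply: (le_trans ul).
have -> : 2^-1 ^+ (2 ^ l) = expR (- (ln 2 * (2 ^ l)%N%:R)) :> R.
  by rewrite expRN mulrC expRM_natl lnK ?posrE// exprVn.
rewrite ler_expR lerN2.
have n2 : (2 <= n)%N by apply: leq_trans nn; rewrite leq_addl.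
have npos : 0 < n%:R :> R by rewrite ltr0n; lia.
have log1 : 1 <= log2 n%:R :> R.
  by rewrite /log2 ler_pdivlMr// mul1r ler_ln ?posrE// ler_nat.
have ll : l%:R <= log2 n%:R :> R.
  rewrite /log2 ler_pdivlMr// mulr_natl -lnXn// ler_ln ?posrE ?exprn_gt0//.
  by rewrite -natrX ler_nat; exact: leq_trans (ge2 l) gl.
have nb : n%:R <= (4 * b * B)%N%:R * ((2 ^ l)%N%:R * log2 n%:R) :> R.
  have : (n <= 2 * b * B * (2 ^ l * l.+1))%N.
    apply: (leq_trans (ltnW gl1)); rewrite /g /B expnS.
    have : (N0 + A * l.+1 <= (N0 + A) * l.+1)%N by nia.
    move: (2 ^ l)%N => t /(leq_mul (leqnn (b * (2 * t))%N)); lia.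
  rewrite -(ler_nat R) => /le_trans; apply.
  rewrite !natrM -[l.+1%:R]natr1.
  have -> : 4 = 2 * 2 :> R by lra.
  rewrite -!mulrA ler_pM2l//.
  have h : l%:R + 1 <= 2 * log2 n%:R :> R by lra.
  have p1 : 0 <= b%:R * (B%:R * (2 ^ l)%N%:R) :> R by rewrite !mulr_ge0.
  have := ler_wpM2l p1 h; lra.
move: nb; set K := (4 * b * B)%N%:R : R; set T := (2 ^ l)%N%:R : R => nb.
have Lg0 : 0 < log2 n%:R :> R by lra.
rewrite -!mulrA ler_pM2l// ler_pdivrMl// ler_pdivrMr//.
by rewrite -mulrA.
Qed.

(** Blocks and gaps of the same length [N] alternate. *)
Lemma u_odd_multiple N i : u (N * (2 * i).+1) <= u N ^+ i.+1 + i%:R * alpha N.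
Proof.
elim: i => [|i IH]; first by rewrite muln0 muln1 expr1 mul0r addr0.
have -> : (N * (2 * i.+1).+1 = N * (2 * i).+1 + N + N)%N by lia.
apply: (le_trans (u_rec _ _ _)); rewrite exprSr -natr1.
have h1 : u (N * (2 * i).+1) * u N <= (u N ^+ i.+1 + i%:R * alpha N) * u N.
  by rewrite ler_wpM2r.
have h2 : i%:R * alpha N * u N <= i%:R * alpha N by rewrite ler_piMr// mulr_ge0.
move: h1; rewrite mulrDl; lra.
Qed.

Lemma powR_above (gamma Q : R) : 0 < gamma ->
  exists n0 : nat, forall n, (n0 <= n)%N -> Q <= n%:R `^ gamma.
Proof.
move=> g0; pose Q' := Num.max 0 Q; have Q0 : 0 <= Q' by rewrite le_max lexx.
have [n0 n0P] := nat_above (Q' `^ gamma^-1); exists n0 => n nn.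
apply: (@le_trans _ _ Q'); first by rewrite le_max lexx orbT.
have -> : Q' = (Q' `^ gamma^-1) `^ gamma by rewrite -powRrM mulVf ?gt_eqF// powRr1.
apply: ge0_ler_powR; rewrite ?nnegrE ?powR_ge0 ?(ltW g0)//.
by apply: (le_trans n0P); rewrite ler_nat.
Qed.

Lemma powR_natX (m l : nat) (gamma : R) : (m ^ l)%N%:R `^ gamma = (m%:R `^ gamma) ^+ l.
Proof.
by rewrite natrX -(powR_mulrn l (ler0n R m)) -(powR_mulrn l (powR_ge0 _ _))
  -!powRrM mulrC.
Qed.

(** Going from [N] to [m * N] with [m = 2 * k] gains [k] blocks of length [N]
    and loses [k - 1] errors [alpha N]. As [gamma < 1], the number [k] can be
    chosen with [k >= m `^ gamma + 1], so that the blocks multiply the exponent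
    by more than the factor [m `^ gamma] that is claimed, while the errors are
    negligible once [N] is large. *)
Lemma u_stretched (c gamma C : R) (n1 : nat) : 0 < c -> 0 < gamma < 1 ->
  (forall n, (n1 <= n)%N -> alpha n <= C * expR (- (c * n%:R `^ gamma))) ->
  exists k N0, [/\ (1 < k)%N, (0 < N0)%N &
    forall l, u (k ^ l * N0) <= expR (- (k%:R `^ gamma) ^+ l)].
Proof.
move=> c0 /andP[g0 g1] H.
have d0 : 0 < 1 - gamma by lra.
have [k [k4 k2]] : exists k : nat, 4 <= k%:R `^ (1 - gamma) /\ (2 <= k)%N.
  have [k0 k0P] := powR_above 4 d0; exists (maxn k0 2).
  by rewrite leq_maxr k0P ?leq_maxl.
have k0 : (0 < k)%N by exact: ltnW.
have kpos : 0 < k%:R :> R by rewrite ltr0n.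
pose m := (2 * k)%N; have m1 : (1 < m)%N.
  by apply: (leq_trans k2); rewrite leq_pmull.
pose beta : R := m%:R `^ gamma.
have b1 : 1 <= beta.
  have -> : 1 = 1 `^ gamma :> R by rewrite powR1.
  apply: ge0_ler_powR; rewrite ?nnegrE ?(ltW g0)//.
  by rewrite ler1n ltnW.
have kb : beta + 1 <= k%:R.
  have kk : k%:R = k%:R `^ gamma * k%:R `^ (1 - gamma) :> R.
    rewrite -powRD; last by apply/implyP => _; rewrite gt_eqF.
    by rewrite addrC subrK powRr1// ltW.
  have b2 : beta <= 2 * k%:R `^ gamma.
    rewrite /beta /m natrM powRM// ler_wpM2r ?powR_ge0//.
    by rewrite -[leRHS]powRr1// ler_powR// ?ler1n// ltW.
  have := ler_wpM2l (powR_ge0 k%:R gamma) k4; rewrite -kk; lra.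
pose C' := Num.max 1 C; have C1 : 1 <= C' by rewrite le_max lexx.
have Cpos : 0 < C' by lra.
have H' n : (n1 <= n)%N -> alpha n <= C' * expR (- (c * n%:R `^ gamma)).
  move=> /H aH; apply: (le_trans aH); rewrite ler_wpM2r ?expR_ge0//.
  by rewrite le_max lexx orbT.
have decay Q : 0 < Q -> exists n0 : nat, forall n, (n0 <= n)%N ->
    C' * expR (- (c * n%:R `^ gamma)) <= Q.
  move=> Q0; have [n0 n0P] := powR_above (ln (C' / Q) / c) g0.
  exists n0 => n /n0P; rewrite ler_pdivrMr// => h.
  rewrite expRN ler_pdivrMr ?expR_gt0// mulrC -ler_pdivrMr//.
  by rewrite -ler_ln ?posrE ?expR_gt0 ?divr_gt0// expRK [leRHS]mulrC.
have asmall e : 0 < e -> exists p, alpha p <= e.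
  move=> /decay[n0 n0P]; exists (maxn n1 n0).
  by apply: le_trans (H' _ (leq_maxl _ _)) _; apply: n0P; exact: leq_maxr.
have [Ns NsP] := u_small asmall (expR_gt0 (-1)).
pose lg := ln (2 * k%:R * C').
have lg0 : 0 <= lg.
  have kk1 : 1 <= k%:R :> R by rewrite ler1n.
  by rewrite /lg ln_ge0// mulr_ege1// mulr_ege1// ler1n.
have [Np NpP] := powR_above ((beta + lg) / c) g0.
have [N0 [N0n1 N0s N0p N01]] : exists N0, [/\ (n1 <= N0)%N, (Ns <= N0)%N, (Np <= N0)%N & (0 < N0)%N].
  by exists (maxn (maxn n1 Ns) (maxn Np 1)); rewrite !leq_max !leqnn !orbT.
exists m, N0; split=> //.
elim=> [|l IH]; first by rewrite expn0 mul1n expr0; exact: NsP.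
set N := (m ^ l * N0)%N in IH; set t := beta ^+ l.
have t1 : 1 <= t by rewrite exprn_ege1.
have -> : beta ^+ l.+1 = beta * t by rewrite exprS.
have mN : (N * (2 * k.-1).+1 <= m ^ l.+1 * N0)%N.
  have -> : (m ^ l.+1 * N0 = N * m)%N by rewrite /N expnS; ring.
  rewrite leq_mul2l; apply/orP; right.
  by rewrite /m -[in leqRHS](prednK k0) mulnS add2n.
apply: (le_trans (u_decr mN)); apply: (le_trans (u_odd_multiple _ _)).
rewrite prednK//.
have Nn1 : (n1 <= N)%N.
  by apply: (leq_trans N0n1); rewrite /N leq_pmull// expn_gt0 ltnW.
have Ng : N%:R `^ gamma = t * N0%:R `^ gamma.
  by rewrite /N natrM powRM// powR_natX.
have aN : k%:R * alpha N <= expR (- (beta * t)) / 2.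
  have := H' _ Nn1; rewrite Ng => aH.
  have := NpP _ N0p; rewrite ler_pdivrMr// => h.
  have e1 : - (c * (t * N0%:R `^ gamma)) <= - (beta * t) - lg by nra.
  have e2 : alpha N <= C' * (expR (- (beta * t)) / (2 * k%:R * C')).
    apply: (le_trans aH); rewrite ler_wpM2l ?(ltW Cpos)//.
    have -> : 2 * k%:R * C' = expR lg by rewrite lnK// posrE !mulr_gt0.
    by rewrite -expRN -expRD ler_expR.
  apply: (le_trans (ler_wpM2l (ltW kpos) e2)).
  rewrite [leLHS](_ : _ = expR (- (beta * t)) / 2)//; field.
  by rewrite !gt_eqF.
have uN : u N ^+ k <= expR (- (beta * t)) / 2.
  apply: (@le_trans _ _ (expR (- t) ^+ k)).
    by apply: lerXn2r; rewrite ?nnegrE ?expR_ge0.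
  rewrite -expRM_natl.
  apply: (@le_trans _ _ (expR (- (beta * t) - 1))); first by rewrite ler_expR; nra.
  rewrite expRD ler_wpM2l ?expR_ge0// expRN lef_pV2 ?posrE ?expR_gt0//.
  by have := expR_ge1Dx (1 : R); lra.
have : k.-1%:R * alpha N <= k%:R * alpha N by rewrite ler_wpM2r// ler_nat leq_pred.
lra.
Qed.

Lemma rate_stretched (c gamma C : R) (n1 b : nat) : 0 < c -> 0 < gamma < 1 ->
  (0 < b)%N ->
  (forall n, (n1 <= n)%N -> alpha n <= C * expR (- (c * n%:R `^ gamma))) ->
  exists c' n0, 0 < c' /\ forall n, (n0 <= n)%N ->
    u (n %/ b) <= expR (- (c' * n%:R `^ gamma)).
Proof.
move=> c0 g01 b0 /(u_stretched c0 g01)[k [N0 [k1 N00 H]]].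
have /andP[g0 g1] := g01.
have kpos : 0 < k%:R :> R by rewrite ltr0n; lia.
pose beta : R := k%:R `^ gamma; have beta0 : 0 < beta by rewrite powR_gt0.
pose M : R := (N0 * b)%N%:R `^ gamma.
have M0 : 0 < M by rewrite powR_gt0// ltr0n muln_gt0 N00.
exists (beta * M)^-1, (N0 * b)%N; split; first by rewrite invr_gt0 mulr_gt0.
move=> n nn.
pose g l := (k ^ l * (N0 * b))%N.
have g0n : (g 0 <= n)%N by rewrite /g expn0 mul1n.
have gi i : (i <= g i)%N.
  by rewrite /g; apply: leq_trans (leq_pmulr _ _); [exact: ltnW (ltn_expl _ _)|rewrite muln_gt0 N00].
have [l /andP[gl gl1]] := bracket g0n gi.
have ul : u (n %/ b) <= expR (- beta ^+ l).
  by apply: le_trans (H l); apply: u_decr; rewrite leq_divRL// -mulnA.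
apply: (le_trans ul); rewrite ler_expR lerN2 ler_pdivrMl ?mulr_gt0//.
apply: (@le_trans _ _ ((g l.+1)%:R `^ gamma)).
  by apply: ge0_ler_powR; rewrite ?nnegrE ?(ltW g0)// ler_nat ltnW.
rewrite /g natrM powRM// powR_natX -/beta -/M exprS.
by rewrite mulrAC.
Qed.

(** The time [n / b] is cut into [k] pieces, [k] of order [ln n], with a gap
    [p] of order [n / ln n] in each. The factor [a ^+ k] is then at most
    [n `^ (- gamma)], and the error of the order of the power [- gamma] of
    [n / ln n]. *)
Lemma rate_polynomial (gamma C : R) (n1 b : nat) : 0 < gamma -> (0 < b)%N ->
  (forall n, (n1 <= n)%N -> alpha n <= C * n%:R `^ (- gamma)) ->
  exists C' n0, 0 < C' /\ forall n, (n0 <= n)%N ->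
    u (n %/ b) <= C' * (log2 n%:R `^ gamma / n%:R `^ gamma).
Proof.
move=> g0 b0 H.
pose a := Num.max (u 1) 2^-1.
have ua : u 1 <= a by rewrite le_max lexx.
have a2 : 2^-1 <= a by rewrite le_max lexx orbT.
have a1 : a < 1 by rewrite gt_max u1 /=; lra.
have a0 : 0 < a by lra.
pose kap := - ln a; have kap0 : 0 < kap by rewrite oppr_gt0 ln_lt0// a0 a1.
pose Hc := gamma / kap + 1; have Hc1 : 1 <= Hc by rewrite /Hc lerDr divr_ge0 ?ltW.
have Hc0 : 0 < Hc by lra.
pose C' := Num.max 1 C; have C1 : 1 <= C' by rewrite le_max lexx.
have H' n : (n1 <= n)%N -> alpha n <= C' * n%:R `^ (- gamma).
  move=> /H aH; apply: (le_trans aH); rewrite ler_wpM2r ?powR_ge0//.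
  by rewrite le_max lexx orbT.
have bpos : 0 < b%:R :> R by rewrite ltr0n.
have [m1 m1P] := log_small (4 * b%:R * Hc).
have [m2 m2P] := log_small (2 * b%:R * Hc * n1.+1%:R).
have [m3 m3P] := ln_large 1.
pose Z := 2 * b%:R * Hc; have Z0 : 0 < Z by rewrite /Z !mulr_gt0//; lra.
exists (1 + C' * Z `^ gamma / (1 - a)), (maxn (maxn m1 m2) m3); split.
  by rewrite ltr_pwDl// divr_ge0 ?mulr_ge0 ?powR_ge0//; lra.
move=> n; rewrite !geq_max => /andP[/andP[/m1P h1 /m2P h2] /m3P h3].
set x := ln n%:R in h1 h2 h3.
have x0 : 0 < x by exact: lt_le_trans ltr01 h3.
have zx : 0 < Z * x by exact: mulr_gt0.
have Cp0 : 0 <= C' by exact: le_trans ler01 C1.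
have d0 : 0 < 1 - a by rewrite subr_gt0.
have npos : 0 < n%:R :> R.
  by apply: lt_le_trans h1; rewrite !mulr_gt0//; lra.
have ln2 : 0 < ln 2 :> R by rewrite ln_gt0// ltr1n.
have ln21 : ln 2 <= 1 :> R.
  by have := le_ln1Dx (x := 1 : R); rewrite (_ : 1 + 1 = 2 :> R)//; apply; lra.
have xlog : x <= log2 n%:R by rewrite /log2 ler_pdivlMr// ler_piMr// ltW.
pose k := (Num.truncn (gamma / kap * x)).+1.
have gx0 : 0 <= gamma / kap * x by rewrite mulr_ge0 ?divr_ge0 ?(ltW g0) ?(ltW kap0) ?(ltW x0).
have /andP[k1 k2] := truncn_itv gx0; rewrite -/k in k2.
have kx : k%:R <= Hc * x by rewrite /k -natr1 /Hc mulrDl mul1r; lra.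
have kpos : 0 < k%:R :> R by rewrite ltr0n.
pose q := (n %/ (b * k))%N.
have qlow : n%:R / (b%:R * k%:R) - 1 <= q%:R :> R.
  rewrite lerBlDr natr1 ler_pdivrMr ?mulr_gt0// -!natrM ler_nat.
  by apply: ltnW; rewrite ltn_ceil// muln_gt0 b0.
have bk : b%:R * k%:R <= b%:R * (Hc * x) by rewrite ler_pM2l.
have big4 : 4 <= n%:R / (b%:R * k%:R) :> R.
  by rewrite ler_pdivlMr ?mulr_gt0//; lra.
have q1 : (1 <= q)%N by rewrite -(ler_nat R); lra.
pose p := q.-1; have pq : p.+1 = q by rewrite prednK.
have pE : p%:R + 1 = q%:R :> R by rewrite natr1 pq.
have plow : n%:R / (Z * x) <= p%:R.
  apply: (@le_trans _ _ (n%:R / (b%:R * k%:R) / 2)); last by lra.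
  rewrite -mulrA -invfM ler_pM2l// lef_pV2 ?posrE ?mulr_gt0//.
  rewrite /Z; lra.
have zx0 : 0 < n%:R / (Z * x) by exact: divr_gt0.
have pn1 : (n1 <= p)%N.
  rewrite -(ler_nat R); apply: le_trans plow.
  rewrite ler_pdivlMr//.
  apply: le_trans h2.
  have -> : 2 * b%:R * Hc * n1.+1%:R * x = n1.+1%:R * (Z * x) by rewrite /Z; ring.
  by rewrite ler_wpM2r ?ler_nat// ltW.
have kpn : (k * p.+1 <= n %/ b)%N.
  rewrite pq leq_divRL//.
  have -> : (k * q * b = q * (b * k))%N by ring.
  exact: leq_divM.
apply: (le_trans (u_decr kpn)); apply: (le_trans (u_spaced _ _ ua a1)).
set L := log2 n%:R `^ gamma.
have ng0 : 0 < n%:R `^ gamma :> R by rewrite powR_gt0.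
have L1 : 1 <= L.
  have -> : 1 = 1 `^ gamma :> R by rewrite powR1.
  by apply: ge0_ler_powR; rewrite ?nnegrE ?(ltW g0) ?(le_trans (ltW x0) xlog) ?(le_trans h3 xlog).
have ak : a ^+ k <= L / n%:R `^ gamma.
  apply: (@le_trans _ _ (n%:R `^ gamma)^-1); last by rewrite ler_peMl// invr_ge0 ltW.
  have -> : a ^+ k = expR (k%:R * - kap) by rewrite expRM_natl /kap opprK lnK.
  have -> : (n%:R `^ gamma)^-1 = expR (- (x * gamma)) :> R.
    by rewrite expRN expRM /x lnK.
  rewrite ler_expR mulrN lerN2; apply: ltW.
  by move: k2; rewrite mulrAC ltr_pdivrMr// mulrC.
have ap : alpha p <= C' * (Z `^ gamma * (L / n%:R `^ gamma)).
  apply: (le_trans (H' _ pn1)); rewrite ler_wpM2l//.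
  have p0 : 0 < p%:R :> R by apply: lt_le_trans plow.
  rewrite powRN mulrA ler_pdivlMr// ler_pdivrMl ?powR_gt0//.
  apply: (@le_trans _ _ ((p%:R * (Z * x)) `^ gamma)).
    apply: ge0_ler_powR; rewrite ?nnegrE ?(ltW g0)//.
      by rewrite mulr_ge0// ltW.
    by rewrite -ler_pdivrMr.
  rewrite (powRM gamma (ltW p0) (ltW zx)) (powRM gamma (ltW Z0) (ltW x0)).
  rewrite ler_wpM2l ?powR_ge0// ler_wpM2l ?powR_ge0//.
  by apply: ge0_ler_powR; rewrite ?nnegrE ?(ltW g0) ?(ltW x0) ?(le_trans (ltW x0) xlog).
rewrite mulrDl mul1r; apply: lerD => //.
by rewrite ler_pdivrMr// mulrAC divfK ?gt_eqF// -mulrA.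
Qed.

Lemma rate_exponential (a : R) (b : nat) : (0 < b)%N -> 0 <= a < 1 ->
  (forall n, u n <= a ^+ n) ->
  exists c C, [/\ 0 < c, 0 < C & forall n : nat, u (n %/ b) <= C * expR (- (c * n%:R))].
Proof.
move=> b0 /andP[a0 a1] H.
pose q := Num.max a 2^-1.
have q2 : 2^-1 <= q by rewrite le_max lexx orbT.
have q1 : q < 1 by rewrite gt_max a1 /=; lra.
have q0 : 0 < q by lra.
have bpos : 0 < b%:R :> R by rewrite ltr0n.
pose c := - ln q / b%:R.
have lq : 0 < - ln q by rewrite oppr_gt0 ln_lt0// q0 q1.
exists c, q^-1; split; [by rewrite divr_gt0|by rewrite invr_gt0|] => n.
apply: (le_trans (H _)); apply: (@le_trans _ _ (q ^+ (n %/ b))).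
  by apply: lerXn2r; rewrite ?nnegrE ?(ltW q0)// le_max lexx.
rewrite ler_pdivlMl// -exprS.
have -> : q ^+ (n %/ b).+1 = expR ((n %/ b).+1%:R * ln q) by rewrite expRM_natl lnK.
have h : n%:R / b%:R <= (n %/ b).+1%:R :> R.
  by rewrite ler_pdivrMr// -natrM ler_nat ltnW// ltn_ceil.
rewrite ler_expR; have := ler_wpM2r (ltW lq) h.
have -> : - (c * n%:R) = - (n%:R / b%:R * - ln q) by rewrite /c; ring.
lra.
Qed.

End rates.

(** * Moments and tails *)

(** For [z <= x + y], concavity gives
    [z `^ theta >= z / (x + y) * (x + y) `^ theta]; add this for [x] and [y]. *)
Lemma powR_subadditive {R : realType} (x y theta : R) : 0 <= x -> 0 <= y ->
  0 < theta <= 1 -> (x + y) `^ theta <= x `^ theta + y `^ theta.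
Proof.
move=> x0 y0 /andP[t0 t1].
have [xy0|xy0] := eqVneq (x + y) 0.
  by rewrite xy0 powR0 ?gt_eqF// addr_ge0 ?powR_ge0.
have s0 : 0 < x + y by rewrite lt_neqAle eq_sym xy0 addr_ge0.
have key z : 0 <= z <= x + y -> z / (x + y) * (x + y) `^ theta <= z `^ theta.
  move=> /andP[z0 zs]; have [->|zn] := eqVneq z 0; first by rewrite !mul0r powR_ge0.
  have u0 : 0 < z / (x + y) by rewrite divr_gt0// lt_neqAle eq_sym zn.
  have u1 : z / (x + y) <= 1 by rewrite ler_pdivrMr// mul1r.
  have -> : z `^ theta = (z / (x + y)) `^ theta * (x + y) `^ theta.
    by rewrite -powRM ?(ltW u0) ?(ltW s0)// divfK.
  rewrite ler_wpM2r ?powR_ge0//.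
  rewrite -[in leLHS](lnK (x := z / (x + y)))// -[in leRHS](lnK (x := z / (x + y)))//.
  rewrite -expRM ler_expR.
  have : ln (z / (x + y)) <= 0 by exact: ln_le0.
  nra.
have kx : x / (x + y) * (x + y) `^ theta <= x `^ theta by apply: key; lra.
have ky : y / (x + y) * (x + y) `^ theta <= y `^ theta by apply: key; lra.
have -> : (x + y) `^ theta =
    x / (x + y) * (x + y) `^ theta + y / (x + y) * (x + y) `^ theta.
  by rewrite -mulrDl -mulrDl divff// mul1r.
exact: lerD.
Qed.

Section stationary_moment.
Context {R : realType} {d} {Om : measurableType d} (P : probability Om R).
Variables (a0 a1 W : Om -> R) (q : R).
Hypothesis ma0 : measurable_fun [set: Om] a0.
Hypothesis ma1 : measurable_fun [set: Om] a1.
Hypothesis mW : measurable_fun [set: Om] W.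
Hypothesis a0_ge0 : forall w, 0 <= a0 w.
Hypothesis a1_ge0 : forall w, 0 <= a1 w.
Hypothesis W_ge0 : forall w, 0 <= W w.
Hypothesis q01 : 0 <= q < 1.
Hypothesis contr : {ae P, forall w, a1 w <= q * a0 w + W w}.
Hypothesis same : forall B, measurable B -> P (a0 @^-1` B) = P (a1 @^-1` B).
Hypothesis W_lty : (\int[P]_w (W w)%:E < +oo)%E.

Let phi (m n : nat) : \bar R := (\int[P]_w (Num.min (q ^+ n * a0 w) m%:R)%:E)%E.

Let q0 : 0 <= q. Proof. by case/andP: q01. Qed.

Let mmin (a : Om -> R) m n : measurable_fun [set: Om] a ->
  measurable_fun [set: Om] (fun w => (Num.min (q ^+ n * a w) m%:R)%:E).
Proof.
move=> ma; apply/measurable_EFinP; apply: measurable_minr => //.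
exact: measurable_funM.
Qed.

Let min_ge0 (a : R) m n : 0 <= a -> 0 <= Num.min (q ^+ n * a) m%:R.
Proof. by move=> a_ge0; rewrite le_min mulr_ge0 ?exprn_ge0/=. Qed.

Let phi_law m n : phi m n = (\int[P]_w (Num.min (q ^+ n * a1 w) m%:R)%:E)%E.
Proof.
pose h (x : R) := (Num.min (q ^+ n * `|x|) m%:R)%:E.
have mh : measurable_fun [set: R] h.
  apply/measurable_EFinP; apply: measurable_minr => //.
  by apply: measurable_funM => //; exact: measurable_normr.
have h0 x : (0 <= h x)%E by rewrite lee_fin min_ge0.
transitivity (\int[P]_w h (a0 w))%E.
  by apply: eq_integral => w _; rewrite /h ger0_norm.
transitivity (\int[P]_w h (a1 w))%E; last first.
  by apply: eq_integral => w _; rewrite /h ger0_norm.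
rewrite -(ge0_integral_law P ma0 mh h0) -(ge0_integral_law P ma1 mh h0).
by apply: eq_measure_integral => B mB _; exact: same.
Qed.

Let C : R := \int[P]_w W w.

Let CE : (\int[P]_w (W w)%:E)%E = C%:E.
Proof.
rewrite /C /Rintegral fineK// ge0_fin_numE//.
by apply: integral_ge0 => w _; rewrite lee_fin.
Qed.

Let phi_step m n : (phi m n <= phi m n.+1 + (q ^+ n * C)%:E)%E.
Proof.
rewrite phi_law EFinM -CE -ge0_integralZl//; last 3 first.
- exact/measurable_EFinP.
- by move=> w _; rewrite lee_fin.
- by rewrite lee_fin exprn_ge0.
rewrite -ge0_integralD//; last 4 first.
- by move=> w _; rewrite lee_fin min_ge0.
- exact: mmin.
- by move=> w _; rewrite -EFinM lee_fin mulr_ge0 ?exprn_ge0.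
- by apply/measurable_EFinP; exact: measurable_funM.
apply: ae_ge0_le_integral => //.
- by move=> w _; rewrite lee_fin min_ge0.
- exact: mmin.
- by move=> w _; rewrite adde_ge0// lee_fin ?min_ge0// mulr_ge0 ?exprn_ge0.
- apply: emeasurable_funD; first exact: mmin.
  by apply/measurable_EFinP; exact: measurable_funM.
move: contr; apply: filterS => w cw _.
rewrite -EFinM -EFinD lee_fin exprSr -mulrA.
have qn : 0 <= q ^+ n by rewrite exprn_ge0.
have := ler_wpM2l qn cw; rewrite mulrDr => H.
have WW : 0 <= q ^+ n * W w by rewrite mulr_ge0.
rewrite -lerBlDr le_min; apply/andP; split.
- have : Num.min (q ^+ n * a1 w) m%:R <= q ^+ n * a1 w by rewrite ge_min lexx.
  lra.
- have : Num.min (q ^+ n * a1 w) m%:R <= m%:R by rewrite ge_min lexx orbT.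
  lra.
Qed.

Let C_ge0 : 0 <= C. Proof. exact: Rintegral_ge0. Qed.

Let phi_sum m n : (phi m 0 <= phi m n + (C * (1 - q ^+ n) / (1 - q))%:E)%E.
Proof.
have q1 : 1 - q != 0 by rewrite gt_eqF// subr_gt0; case/andP: q01.
elim: n => [|n IH]; first by rewrite expr0 subrr mulr0 mul0r adde0.
apply: (le_trans IH); apply: (le_trans (leeD2r _ (phi_step m n))).
rewrite -addeA -EFinD leeD2l// lee_fin exprS.
by rewrite le_eqVlt; apply/orP; left; apply/eqP; field.
Qed.

Let phi_vanish m (eps : R) : 0 < eps -> exists n, (phi m n <= eps%:E)%E.
Proof.
move=> e0.
have cv : (phi m n @[n --> \oo] --> (0:R)%:E)%E.
  have -> : (0:R)%:E = (\int[P]_w (0:R)%:E)%E by rewrite integral0.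
  apply: (@dominated_cvg _ _ _ P _ measurableT _ _ (fun=> m%:R%:E)) => //.
  - by move=> n; exact: mmin.
  - move=> w _; apply: cvg_EFin; first exact: nearW.
    apply: (@squeeze_cvgr _ _ _ _ (fun=> 0) (fun n => q ^+ n * a0 w)).
    + by apply: nearW => n /=; rewrite min_ge0//= ge_min lexx.
    + exact: cvg_cst.
    + rewrite -[X in _ --> X](mul0r (a0 w)); apply: cvgM; last exact: cvg_cst.
      by apply: cvg_expr; rewrite ger0_norm//; case/andP: q01.
  - apply: (@bounded_integrable _ _ _ _ _ (fun=> m%:R) m%:R) => // w.
    by rewrite ger0_norm.
  - move=> n w _; rewrite gee0_abs lee_fin ?min_ge0//.
    by rewrite ge_min lexx orbT.
move/fine_cvgP : cv => [fin /cvgrPdist_le/(_ _ e0)].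
move=> near1; near \oo => n; exists n.
have fn : phi m n \is a fin_num by near: n.
have : `|0 - fine (phi m n)| <= eps by near: n.
rewrite sub0r normrN ger0_norm ?fine_ge0//; last first.
  by apply: integral_ge0 => w _; rewrite lee_fin min_ge0.
by rewrite -lee_fin fineK.
Unshelve. all: by end_near. Qed.

(** If the mean of [a0] were known to be finite, the inequality [contr] would
    bound it by [C / (1 - q)]. Without this knowledge it is iterated on
    truncations: [phi m n], the mean of [a0] scaled by [q ^+ n] and cut at [m],
    is finite, decreases by at most [q ^+ n * C] at each step, and vanishes as
    [n] grows by dominated convergence. So all truncations at [m] have mean at
    most [C / (1 - q)], and monotone convergence concludes. *)
Lemma stationary_moment : (\int[P]_w (a0 w)%:E < +oo)%E.
Proof.
have q1 : 0 < 1 - q by rewrite subr_gt0; case/andP: q01.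
have bound m : (phi m 0 <= (C / (1 - q))%:E)%E.
  apply/lee_addgt0Pr => e e0; have [n nP] := phi_vanish m e0.
  apply: (le_trans (phi_sum m n)); rewrite addeC; apply: leeD => //.
  rewrite lee_fin ler_wpM2r ?invr_ge0 ?(ltW q1)// ler_piMr//.
  by rewrite gerBl exprn_ge0.
apply: (@le_lt_trans _ _ (C / (1 - q))%:E); last by rewrite ltry.
have lim w : limn (fun m : nat => (Num.min (q ^+ 0 * a0 w) m%:R)%:E) = (a0 w)%:E.
  apply: cvg_lim => //; apply: cvg_near_cst.
  have [k kP] := nat_above (a0 w).
  exists k => // m /= km; rewrite expr0 mul1r; congr EFin; apply/min_idPl.
  by apply: (le_trans kP); rewrite ler_nat.
under eq_integral do rewrite -lim.
rewrite monotone_convergence//.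
- apply: lime_le; last by apply: nearW => m; exact: bound.
  apply: ereal_nondecreasing_is_cvgn => m m' mm.
  apply: ge0_le_integral => //.
  + by move=> w _; rewrite lee_fin min_ge0.
  + exact: mmin.
  + exact: mmin.
  + by move=> w _; rewrite lee_fin le_min ge_min lexx /= ge_min ler_nat mm orbT.
- by move=> n; exact: mmin.
- by move=> n w _; rewrite lee_fin min_ge0.
- move=> w _ m m' mm.
  by rewrite lee_fin le_min ge_min lexx /= ge_min ler_nat mm orbT.
Qed.

End stationary_moment.

(** Markov's inequality for [Z `^ theta]: the radius is exponential in [j],
    and [j] is at least half of [n]. *)
Lemma radius_tail {R : realType} {d} {Om : measurableType d}
    (P : probability Om R) (Z : Om -> R) (rho r theta : R) :
  0 < r -> 0 < rho < 1 -> 0 < theta ->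
  measurable_fun [set: Om] Z -> (forall w, 0 <= Z w) ->
  (\int[P]_w (Z w `^ theta)%:E < +oo)%E ->
  exists2 C : R, 0 <= C & forall j n : nat, (n <= 2 * j)%N ->
    fine (P [set w | radius rho r j < Z w]) <=
    C * expR (- (theta * - ln ((1 + rho) / 2) / 2 * n%:R)).
Proof.
move=> r0 /andP[rho0 rho1] t0 mZ Z0 EZ.
set tau := (1 + rho) / 2.
have tau0 : 0 < tau by rewrite /tau; lra.
have tau1 : tau < 1 by rewrite /tau; lra.
pose kap := - ln tau; have kap0 : 0 < kap by rewrite oppr_gt0 ln_lt0// tau0 tau1.
pose D := near_dist rho r.
have D0 : 0 < D by rewrite /D /near_dist divr_gt0 ?mulr_gt0//; lra.
pose M := \int[P]_w (Z w `^ theta).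
have mZt : measurable_fun [set: Om] (fun w => Z w `^ theta).
  apply: (@measurableT_comp _ _ _ _ _ _ (fun x : R => x `^ theta)) mZ.
  exact: measurable_powR.
have ME : (\int[P]_w (Z w `^ theta)%:E = M%:E)%E.
  rewrite /M /Rintegral fineK// ge0_fin_numE//.
  by apply: integral_ge0 => w _; rewrite lee_fin powR_ge0.
have M0 : 0 <= M by apply: Rintegral_ge0 => w _; exact: powR_ge0.
have Dt : 0 < D `^ theta by rewrite powR_gt0.
exists (M / D `^ theta); first by rewrite divr_ge0// ltW.
move=> j n nj.
have rjE : radius rho r j = D * expR (kap * j%:R).
  by rewrite /radius -/tau -/D mulrC [kap * _]mulrC expRM_natl /kap expRN lnK ?posrE// mulrC.
have rj : radius rho r j `^ theta = D `^ theta * expR (theta * kap * j%:R).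
  rewrite rjE powRM ?(ltW D0) ?expR_ge0//; congr (_ * _).
  by rewrite -expRM; congr expR; ring.
have rj0 : 0 < radius rho r j by rewrite rjE mulr_gt0 ?expR_gt0.
have rjt0 : 0 < radius rho r j `^ theta by rewrite powR_gt0.
have mk : radius rho r j `^ theta * fine (P [set w | radius rho r j < Z w]) <= M.
  have mA : measurable [set w | radius rho r j < Z w].
    rewrite (_ : [set w | _] = ~` ([set: Om] `&` [set w | Z w <= radius rho r j])).
      by apply: measurableC; apply: measurable_fun_le.
    by rewrite setTI; apply/seteqP; split => w /=; rewrite ltNge => /negP.
  rewrite -lee_fin EFinM fineK ?fin_num_measure// -ME.
  have := @le_integral_abse _ _ _ P _ measurableT (fun w => (Z w `^ theta)%:E)
    (radius rho r j `^ theta) _ rjt0.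
  move=> /(_ ((measurable_EFinP _ _).2 mZt)) H.
  apply: le_trans (le_trans H _); last first.
    by rewrite le_eqVlt; apply/orP; left; apply/eqP; apply: eq_integral => w _; rewrite gee0_abs// lee_fin powR_ge0.
  rewrite lee_pmul2l//; apply: le_measure.
  - by rewrite inE.
  - rewrite inE setTI; rewrite (_ : [set x | _] = [set w | radius rho r j `^ theta <= Z w `^ theta]).
      by rewrite -[X in measurable X]setTI; apply: measurable_fun_le.
    by apply/seteqP; split => w /=; rewrite ger0_norm ?powR_ge0// lee_fin.
  - move=> w /= rw; split=> //; rewrite ger0_norm ?powR_ge0// lee_fin.
    by apply: ge0_ler_powR; rewrite ?nnegrE ?(ltW t0) ?(ltW rj0) ?(ltW rw).
rewrite -ler_pdivlMl// in mk; apply: (le_trans mk).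
rewrite rj invfM [leLHS]mulrC mulrA ler_wpM2l ?divr_ge0 ?(ltW Dt)//.
rewrite -expRN ler_expR lerN2.
have -> : theta * - ln tau / 2 * n%:R = theta * kap * (n%:R / 2) by rewrite /kap; ring.
rewrite ler_wpM2l ?mulr_ge0 ?(ltW t0) ?(ltW kap0)// ler_pdivrMr// mulrC.
by rewrite -natrM ler_nat.
Qed.

(** * Independence of the past from the fresh noise *)
Section generated_independence.
Context {R : realType} {d} {Om : measurableType d} (P : probability Om R).

Lemma independent_generated (G : set (set Om)) (B : set Om) :
  G `<=` measurable -> setI_closed G -> G [set: Om] -> measurable B ->
  (forall A, G A -> P (A `&` B) = (P A * P B)%E) ->
  forall A, <<s G >> A -> P (A `&` B) = (P A * P B)%E.
Proof.
move=> Gm GI GT mB GB A sA.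
have b0 : 0 <= fine (P B) by rewrite fine_ge0.
pose bn : {nonneg R} := NngNum b0.
pose m1 : {measure set Om -> \bar R} := mrestr P mB.
pose m2 : {measure set Om -> \bar R} := mscale bn P.
have m2E C : m2 C = (P C * P B)%E.
  by rewrite /m2 /= /mscale /= fineK ?fin_num_measure// muleC.
rewrite -m2E; apply: (g_sigma_algebra_measure_unique G Gm (fun=> setT) _ _ m1 m2) => //.
- by rewrite bigcup_const.
- by move=> C GC; rewrite m2E -GB.
- move=> k; have : (m1 setT <= 1)%E.
    by apply: probability_le1; exact: measurableI.
  by move=> /le_lt_trans; apply; rewrite ltry.
Qed.

End generated_independence.

Section generated_measurability.
Context {d} {Om : measurableType d} {dT} {T : measurableType dT}.

Lemma measurable_generated (G : set (set Om)) (Z : Om -> T) :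
  (forall B, measurable B -> <<s G >> (Z @^-1` B)) ->
  measurable_fun [set: g_sigma_algebraType G] (Z : g_sigma_algebraType G -> T).
Proof. by move=> GZ _ B mB; rewrite setTI; exact: GZ. Qed.

Lemma sigma_gen_preimage (I : Type) (J : set I) (Z : I -> Om -> T) i B :
  J i -> measurable B -> sigma_gen J Z (Z i @^-1` B).
Proof.
move=> Ji mB; apply: sub_sigma_algebra; exists i => //.
by exists B => //; rewrite setTI.
Qed.

Lemma sigma_gen_min (I : Type) (J : set I) (Z : I -> Om -> T) (G : set (set Om)) :
  (forall i B, J i -> measurable B -> <<s G >> (Z i @^-1` B)) ->
  sigma_gen J Z `<=` <<s G >>.
Proof.
move=> H; apply: smallest_sub; first exact: smallest_sigma_algebra.
by move=> _ [i Ji [B mB <-]]; rewrite setTI; exact: H.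
Qed.

End generated_measurability.

(** The initial state is independent of the environment at nonnegative times
    only, and the recursion reads no other times. Reflecting the time axis
    yields a path indexed by all integers that carries just this part of the
    environment. *)
Definition abs_path {Om F : Type} (X : int -> Om -> F) (w : Om) : int -> F :=
  fun t => X `|t|%N%:Z w.

Section nonanticipative.
Context {R : realType} {dE dF dV d} {E : measurableType dE} {F : measurableType dF}
  {V : measurableType dV} {Om : measurableType d} (P : probability Om R).
Variables (X : int -> Om -> F) (eps : int -> Om -> V) (Y : int -> Om -> E).

Lemma nonanticipative_noise (t : int) :
  independent_sigma P (sigma_gen [set s | t < s] eps)
    <<s sigma_gen [set: int] X `|` sigma_gen [set s | s <= t] Y >> ->
  forall (A : set (E * path_space F)) B, measurable A -> measurable B ->
  P ((fun w => (Y t w, abs_path X w : path_space F)) @^-1` A `&` eps (t + 1) @^-1` B) =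
  (P ((fun w => (Y t w, abs_path X w : path_space F)) @^-1` A) * P (eps (t + 1) @^-1` B))%E.
Proof.
move=> ind A B mA mB.
set G := _ `|` _ in ind.
have mY : measurable_fun [set: g_sigma_algebraType G] (Y t : g_sigma_algebraType G -> E).
  apply: measurable_generated => C mC; apply: sub_sigma_algebra; right.
  by apply: sigma_gen_preimage => //=.
have mX s : measurable_fun [set: g_sigma_algebraType G] (X s : g_sigma_algebraType G -> F).
  apply: measurable_generated => C mC; apply: sub_sigma_algebra; left.
  by apply: sigma_gen_preimage.
have mYX : measurable_fun [set: g_sigma_algebraType G]
   (fun w : g_sigma_algebraType G => (Y t w, abs_path X w : path_space F)).
  apply: measurable_fun_pair => //.
  by apply: (@measurable_path _ _ _ _ (fun t => X `|t|%N%:Z : g_sigma_algebraType G -> F)).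
have := mYX measurableT _ mA; rewrite setTI => sA.
rewrite setIC muleC; apply: ind => //.
by apply: sigma_gen_preimage => //=; rewrite ltrDl.
Qed.

End nonanticipative.

Section forward_recursion.
Context {R : realType} {dE dF dV d} {E : measurableType dE} {F : measurableType dF}
  {V : measurableType dV} {Om : measurableType d} (P : probability Om R).
Variables (f : E * F * V -> E) (X : int -> Om -> F) (eps : nat -> Om -> V)
  (Y : nat -> Om -> E).
Hypothesis mf : measurable_fun [set: _] f.
Hypothesis mX : forall t, measurable_fun [set: Om] (X t).
Hypothesis iid_eps : iid P eps.
Hypothesis indep_X_eps :
  independent_sigma P (sigma_gen [set: int] X) (sigma_gen [set: nat] eps).
Hypothesis mY0 : measurable_fun [set: Om] (Y 0%N).
Hypothesis recY : forall n w, Y n.+1 w = f (Y n w, X n%:Z w, eps n.+1 w).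
Hypothesis indep_Y0 :
  independent_sigma P (sigma_gen [set: unit] (fun _ => Y 0%N))
    (sigma_gen [set: nat] (fun (t : nat) w => (X t%:Z w, eps t.+1 w))).

Let meps i : measurable_fun [set: Om] (eps i). Proof. by case: iid_eps. Qed.

Lemma measurable_recursion n : measurable_fun [set: Om] (Y n).
Proof.
elim: n => [//|n IH]; have -> : Y n.+1 = fun w => f (Y n w, X n%:Z w, eps n.+1 w).
  by apply/funext => w; exact: recY.
apply: (measurableT_comp mf); apply: measurable_fun_pair => //.
exact: measurable_fun_pair.
Qed.

Let noise (k : nat) (Bs : nat -> set V) : set Om :=
  \bigcap_(i in [set` iota 1 k]) (eps i @^-1` Bs i).

(** A pi-system that generates a sigma-algebra containing the path of the
    environment and the states up to time [n]; on its sets, the independence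
    from the noise at time [n.+1] is a product formula. *)
Let past (n : nat) : set (set Om) := [set S | exists A0 C Bs,
  [/\ measurable A0, sigma_gen [set s : int | 0 <= s] X C,
      (forall i, measurable (Bs i)) &
      S = Y 0%N @^-1` A0 `&` C `&` noise n Bs]].

Let noise_joint k Bs : (forall i, measurable (Bs i)) ->
  sigma_gen [set: nat] (fun (t : nat) w => (X t%:Z w, eps t.+1 w)) (noise k Bs).
Proof.
move=> mB.
pose G := \bigcup_(i in [set: nat]) preimage_set_system [set: Om]
   (fun w => (X i%:Z w, eps i.+1 w)) measurable.
suff : measurable (noise k Bs : set (g_sigma_algebraType G)) by [].
apply: fin_bigcap_measurable; first exact: finite_seq.
move=> i; rewrite /= mem_iota => /andP[i1 _].
apply: sub_sigma_algebra; exists i.-1 => //; exists (setT `*` Bs i).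
  by apply: measurableX.
by rewrite setTI prednK//; apply/seteqP; split => w //=; case.
Qed.

Let past_joint C : sigma_gen [set s : int | 0 <= s] X C ->
  sigma_gen [set: nat] (fun (t : nat) w => (X t%:Z w, eps t.+1 w)) C.
Proof.
apply: sigma_gen_min => -[i|//] B _ mB; apply: sub_sigma_algebra.
exists i => //; exists (B `*` setT); first exact: measurableX.
by rewrite setTI; apply/seteqP; split => w //=; case.
Qed.

Let noise_eps k Bs : (forall i, measurable (Bs i)) -> sigma_gen [set: nat] eps (noise k Bs).
Proof.
move=> mB; pose G := \bigcup_(i in [set: nat]) preimage_set_system [set: Om] (eps i) measurable.
suff : measurable (noise k Bs : set (g_sigma_algebraType G)) by [].
apply: fin_bigcap_measurable; first exact: finite_seq.
by move=> i _; apply: sub_sigma_algebra; exists i => //; exists (Bs i) => //; rewrite setTI.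
Qed.

Let sigma_genI (J : set int) C C' : sigma_gen J X C -> sigma_gen J X C' ->
  sigma_gen J X (C `&` C').
Proof.
pose G := \bigcup_(i in J) preimage_set_system [set: Om] (X i) measurable.
exact: (@measurableI _ (g_sigma_algebraType G)).
Qed.

Let past_prob A0 C k Bs : measurable A0 -> sigma_gen [set s : int | 0 <= s] X C ->
  (forall i, measurable (Bs i)) ->
  P (Y 0%N @^-1` A0 `&` C `&` noise k Bs) =
  (P (Y 0%N @^-1` A0) * (P C * \prod_(i <- iota 1 k) P (eps i @^-1` Bs i)))%E.
Proof.
move=> mA sC mB; rewrite -setIA indep_Y0//.
- congr (_ * _)%E; rewrite indep_X_eps//; last exact: noise_eps.
    by congr (_ * _)%E; case: iid_eps => _ + _; apply => //; exact: iota_uniq.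
  apply: sigma_gen_min sC => i B _ mB'; exact: sigma_gen_preimage.
- exact: (@sigma_gen_preimage _ _ _ _ _ _ (fun _ : unit => Y 0%N) tt).
- pose G := \bigcup_(i in [set: nat]) preimage_set_system [set: Om]
    (fun w => (X i%:Z w, eps i.+1 w)) measurable.
  by apply: (@measurableI _ (g_sigma_algebraType G)); [exact: past_joint|exact: noise_joint].
Qed.

Let noiseS n Bs B : noise n Bs `&` eps n.+1 @^-1` B =
  noise n.+1 (fun i => if i == n.+1 then B else Bs i).
Proof.
have inI k i : [set` iota 1 k] i = (0 < i <= k)%N :> Prop.
  by rewrite /= mem_iota add1n ltnS.
apply/seteqP; split => w.
  move=> [H1 H2] i; rewrite inI => /andP[i1]; rewrite leq_eqVlt => /orP[/eqP ->|i2] /=.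
    by rewrite eqxx.
  by rewrite ltn_eqF//; apply: H1; rewrite inI i1.
move=> H; split; last by have := H n.+1; rewrite inI /= eqxx ltnSn; exact.
move=> i; rewrite inI => /andP[i1 i2].
by have := H i; rewrite inI i1 leqW//= ltn_eqF//; exact.
Qed.

Let past_indep n S B : past n S -> measurable B ->
  P (S `&` eps n.+1 @^-1` B) = (P S * P (eps n.+1 @^-1` B))%E.
Proof.
move=> [A0 [C [Bs [mA sC mB ->]]]] mB'.
rewrite -setIA noiseS !past_prob//; last by move=> i; case: eqP.
rewrite -!muleA; congr (_ * (_ * _))%E.
rewrite (_ : iota 1 n.+1 = iota 1 n ++ [:: n.+1]); last first.
  by rewrite -[X in iota _ X](addn1 n) iotaD add1n.
rewrite big_cat /= big_seq1 eqxx; congr (_ * _)%E.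
rewrite big_seq [RHS]big_seq; apply: eq_bigr => i; rewrite mem_iota => /andP[i1 i2].
by rewrite ifN//; apply/eqP; lia.
Qed.

Let sigma_genT (J : set int) : sigma_gen J X [set: Om].
Proof.
pose G := \bigcup_(i in J) preimage_set_system [set: Om] (X i) measurable.
exact: (@measurableT _ (g_sigma_algebraType G)).
Qed.

Let noiseT k : noise k (fun=> setT) = setT.
Proof. by apply/seteqP; split => w // _ i _. Qed.

Let past_closed n : setI_closed (past n).
Proof.
move=> _ _ [A0 [C [Bs [mA sC mB ->]]]] [A1 [C1 [Bs1 [mA1 sC1 mB1 ->]]]].
exists (A0 `&` A1), (C `&` C1), (fun i => Bs i `&` Bs1 i); split.
- exact: measurableI.
- exact: sigma_genI.
- by move=> i; exact: measurableI.
- rewrite preimage_setI /noise; under [X in _ = _ `&` X]eq_bigcapr do rewrite preimage_setI.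
  by rewrite bigcapI; rewrite !setIA; apply/seteqP; split => w /=; tauto.
Qed.

Let past_measurable n : past n `<=` measurable.
Proof.
move=> _ [A0 [C [Bs [mA sC mB ->]]]].
apply: measurableI; first apply: measurableI.
- by rewrite -[X in measurable X]setTI; exact: mY0.
- by move: sC; exact: (sigma_gen_measurable mX).
- apply: fin_bigcap_measurable; first exact: finite_seq.
  by move=> i _; rewrite -[X in measurable X]setTI; exact: meps.
Qed.

Let pastT n : past n [set: Om].
Proof.
exists setT, setT, (fun=> setT); split; [by []|exact: sigma_genT|by []|].
by rewrite noiseT !setIT.
Qed.

Let measurable_past n k : (k <= n)%N ->
  measurable_fun [set: g_sigma_algebraType (past n)] (Y k : g_sigma_algebraType (past n) -> E).
Proof.
elim: k => [_|k IH kn].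
  apply: measurable_generated => B mB; apply: sub_sigma_algebra.
  exists B, setT, (fun=> setT); split; [by []|exact: sigma_genT|by []|].
  by rewrite noiseT !setIT.
have -> : Y k.+1 = fun w => f (Y k w, X k%:Z w, eps k.+1 w).
  by apply/funext => w; exact: recY.
apply: (measurableT_comp mf); apply: measurable_fun_pair; last first.
  apply: measurable_generated => B mB; apply: sub_sigma_algebra.
  exists setT, setT, (fun i => if i == k.+1 then B else setT); split => //.
    by move=> i; case: eqP.
  rewrite preimage_setT !setTI; apply/seteqP; split => w.
    by move=> H i _ /=; case: eqP => // ->.
  by move=> /(_ k.+1); rewrite /= eqxx; apply; rewrite mem_iota; lia.
apply: measurable_fun_pair; first by apply: IH; exact: ltnW.
apply: measurable_generated => B mB; apply: sub_sigma_algebra.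
exists setT, (X k%:Z @^-1` B), (fun=> setT); split => //.
- exact: sigma_gen_preimage.
- by rewrite noiseT preimage_setT setTI setIT.
Qed.

Lemma recursion_noise n (A : set (E * path_space F)) B : measurable A -> measurable B ->
  P ((fun w => (Y n w, abs_path X w : path_space F)) @^-1` A `&` eps n.+1 @^-1` B) =
  (P ((fun w => (Y n w, abs_path X w : path_space F)) @^-1` A) * P (eps n.+1 @^-1` B))%E.
Proof.
move=> mA mB.
apply: (@independent_generated _ _ _ P (past n)).
- exact: past_measurable.
- exact: past_closed.
- exact: pastT.
- by rewrite -[X in measurable X]setTI; exact: meps.
- by move=> S pS; exact: past_indep.
have mYX : measurable_fun [set: g_sigma_algebraType (past n)]
   (fun w : g_sigma_algebraType (past n) => (Y n w, abs_path X w : path_space F)).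
  apply: measurable_fun_pair; first exact: measurable_past.
  apply: (@measurable_path _ _ _ _ (fun t => X `|t|%N%:Z : g_sigma_algebraType (past n) -> F)).
  move=> t; apply: measurable_generated => C mC; apply: sub_sigma_algebra.
  exists setT, (X `|t|%N%:Z @^-1` C), (fun=> setT); split => //.
  - exact: sigma_gen_preimage.
  - by rewrite noiseT preimage_setT setTI setIT.
by have := mYX measurableT _ mA; rewrite setTI.
Qed.

End forward_recursion.

(** * Comparison with the stationary solution *)
Lemma measurable_mdist {R : realType} {dE} {E : polishType dE R} (y : E) :
  measurable_fun [set: E] (fun z => mdist y z).
Proof.
apply: (measurability _ (RGenInftyO.measurableE R)) => _ [_ [a ->] <-].
rewrite setTI (_ : _ @^-1` _ = ball y a).
  by rewrite measurable_borel; apply: sub_sigma_algebra; exact: open_mball.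
by rewrite ballEmdist; apply/seteqP; split => z /=; rewrite in_itv.
Qed.

Lemma stationary_law {R : realType} {dT d} {T : measurableType dT}
    {Om : measurableType d} (P : probability Om R) (Z : int -> Om -> T) t C :
  stationary P Z -> measurable C -> P (Z 0 @^-1` C) = P (Z t @^-1` C).
Proof.
move=> statZ mC; have := statZ t [set x : int -> T | C (x 0)].
rewrite /= add0r; apply; apply: sub_sigma_algebra; exists 0 => //.
by exists C => //; rewrite setTI.
Qed.

Lemma contractive_reach {R : realType} (rho r K : R) : 0 < r -> 0 < rho < 1 ->
  exists l, K <= radius rho r l.
Proof.
move=> r0 /andP[rho0 rho1].
pose tau := (1 + rho) / 2.
have tau01 : 0 <= tau < 1 by rewrite /tau; lra.
have tau0 : 0 < tau by rewrite /tau; lra.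
have D0 : 0 < near_dist rho r by rewrite /near_dist divr_gt0 ?mulr_gt0//; lra.
pose K' := Num.max 1 K; have K1 : 0 < K' by rewrite lt_max ltr01.
have [l lP] := exprn_small tau01 (divr_gt0 D0 K1).
exists l; apply: (@le_trans _ _ K'); first by rewrite le_max lexx orbT.
by rewrite /radius -/tau exprVn ler_pdivlMr ?exprn_gt0// -ler_pdivlMl// mulrC.
Qed.

Section comparison.
Context {R : realType} {dE dF dV d d'} {E : polishType dE R} {F : polishType dF R}
  {V : measurableType dV} {Om : measurableType d} {Om' : measurableType d'}.
Variables (f : E * F * V -> E).
Hypothesis mf : measurable_fun [set: _] f.
Variables (P : probability Om R) (X : int -> Om -> F).
Hypothesis mX : forall t, measurable_fun [set: Om] (X t).
Hypothesis statX : stationary P X.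
Variable eps : nat -> Om -> V.
Hypothesis iid_eps : iid P eps.
Hypothesis indep_X_eps :
  independent_sigma P (sigma_gen [set: int] X) (sigma_gen [set: nat] eps).
Variables rho r : R.
Hypothesis assA : contractive_modulo f rho r.
Variables (nu : R.-pker (F * (E * E)) ~> E) (eta : F -> R) (K : R).
Hypothesis assB : minorization P f (eps 0%N) rho r nu eta K.
Variables (y0 : E) (theta : R).
Hypothesis theta01 : 0 < theta <= 1.
Hypothesis moment_f :
  ('E_P[(fun w => mdist y0 (f (y0, X 0 w, eps 1%N w)) `^ theta)%R] < +oo)%E.
Variable Y : nat -> Om -> E.
Hypothesis mY0 : measurable_fun [set: Om] (Y 0%N).
Hypothesis recY : forall n w, Y n.+1 w = f (Y n w, X n%:Z w, eps n.+1 w).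
Hypothesis moment_Y0 : ('E_P[(fun w => mdist y0 (Y 0%N w) `^ theta)%R] < +oo)%E.
Hypothesis indep_Y0 :
  independent_sigma P (sigma_gen [set: unit] (fun _ => Y 0%N))
    (sigma_gen [set: nat] (fun (t : nat) w => (X t%:Z w, eps t.+1 w))).
Variables (P' : probability Om' R) (X' : int -> Om' -> F).
Hypothesis mX' : forall t, measurable_fun [set: Om'] (X' t).
Hypothesis lawX' : same_law P' X' P X.
Variable eps' : int -> Om' -> V.
Hypothesis iid_eps' : iid P' eps'.
Hypothesis law_eps' : same_law P' (fun n : nat => eps' n%:Z) P eps.
Hypothesis indep_X_eps' :
  independent_sigma P' (sigma_gen [set: int] X') (sigma_gen [set: int] eps').
Variable Ystar : int -> Om' -> E.
Hypothesis solY : stationary_solution P' f X' eps' Ystar.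

Let meps i : measurable_fun [set: Om] (eps i). Proof. by case: iid_eps. Qed.
Let meps' i : measurable_fun [set: Om'] (eps' i). Proof. by case: iid_eps'. Qed.
Let mY n : measurable_fun [set: Om] (Y n).
Proof. exact: (measurable_recursion mf mX iid_eps mY0 recY). Qed.
Let mYs t : measurable_fun [set: Om'] (Ystar t). Proof. exact: solution_measurable solY t. Qed.

Let L : probability V R := law P (meps 0).

Let law_e n B : measurable B -> P (eps n @^-1` B) = L B.
Proof. by move=> mB; case: iid_eps => _ _; apply. Qed.

Let law_e' t B : measurable B -> P' (eps' t @^-1` B) = L B.
Proof.
move=> mB; transitivity (P' (eps' 0 @^-1` B)); first by case: iid_eps' => _ _; apply.
have := law_eps' (A := [set x : nat -> V | B (x 0%N)]); apply.
apply: sub_sigma_algebra; exists 0%N => //.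
by exists B => //; rewrite setTI.
Qed.

Let lawX0 C : measurable C -> P' (X' 0 @^-1` C) = P (X 0 @^-1` C).
Proof.
move=> mC; have := lawX' (A := [set x : int -> F | C (x 0)]); apply.
apply: sub_sigma_algebra; exists 0 => //.
by exists C => //; rewrite setTI.
Qed.

Let rho01 : 0 < rho < 1. Proof. by case: assA. Qed.
Let r0 : 0 < r. Proof. by case: assA. Qed.
Let th0 : 0 < theta. Proof. by case/andP: theta01. Qed.

Let moment_f' :
  (\int[P']_w (mdist y0 (f (y0, X' 0 w, eps' 1 w)) `^ theta)%:E < +oo)%E.
Proof.
pose h (z : F * V) : \bar R := (mdist y0 (f (y0, z.1, z.2)) `^ theta)%:E.
have mh : measurable_fun [set: F * V] h.
  apply/measurable_EFinP.
  apply: (@measurableT_comp _ _ _ _ _ _ (fun x : R => x `^ theta)).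
    exact: measurable_powR.
  apply: (measurableT_comp (measurable_mdist y0)); apply: (measurableT_comp mf).
  by apply: measurable_fun_pair => //; exact: measurable_fun_pair.
have h0 z : (0 <= h z)%E by rewrite lee_fin powR_ge0.
have ind (A : set F) (B : set V) : measurable A -> measurable B ->
    P (X 0 @^-1` A `&` eps 1%N @^-1` B) = (P (X 0 @^-1` A) * P (eps 1%N @^-1` B))%E.
  by move=> mA mB; apply: indep_X_eps; exact: sigma_gen_preimage.
have ind' (A : set F) (B : set V) : measurable A -> measurable B ->
    P' (X' 0 @^-1` A `&` eps' 1 @^-1` B) = (P' (X' 0 @^-1` A) * P' (eps' 1 @^-1` B))%E.
  by move=> mA mB; apply: indep_X_eps'; exact: sigma_gen_preimage.
suff -> : (\int[P']_w (mdist y0 (f (y0, X' 0 w, eps' 1 w)) `^ theta)%:E)%E =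
  (\int[P]_w (mdist y0 (f (y0, X 0 w, eps 1%N w)) `^ theta)%:E)%E.
  by move: moment_f; rewrite unlock.
rewrite (freezing_ge0 (mX' 0) (meps' 1) (@law_e' 1) ind' mh h0).
rewrite (freezing_ge0 (mX 0) (meps 1%N) (@law_e 1%N) ind mh h0).
pose g (x : F) : \bar R := (\int[L]_v h (x, v))%E.
have mg : measurable_fun [set: F] g by exact: measurable_fun_fubini_tonelli_F.
have g0 x : (0 <= g x)%E by exact: integral_ge0.
rewrite -(ge0_integral_law P' (mX' 0) mg g0) -(ge0_integral_law P (mX 0) mg g0).
by apply: eq_measure_integral => C mC _; exact: lawX0.
Qed.

Let mpow (g : Om' -> R) : measurable_fun [set: Om'] g ->
  measurable_fun [set: Om'] (fun w => g w `^ theta).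
Proof.
move=> mg; apply: (@measurableT_comp _ _ _ _ _ _ (fun x : R => x `^ theta)) mg.
exact: measurable_powR.
Qed.

Lemma stationary_solution_moment : (\int[P']_w (mdist y0 (Ystar 0 w) `^ theta)%:E < +oo)%E.
Proof.
have m1 t : measurable_fun [set: Om'] (fun w => mdist y0 (Ystar t w)).
  by apply: (measurableT_comp (measurable_mdist y0)); exact: mYs.
have mD : measurable_fun [set: Om'] (fun w => mdist y0 (f (y0, X' 0 w, eps' 1 w))).
  apply: (measurableT_comp (measurable_mdist y0)); apply: (measurableT_comp mf).
  by apply: measurable_fun_pair => //; exact: measurable_fun_pair.
apply: (@stationary_moment _ _ _ P' (fun w => mdist y0 (Ystar 0 w) `^ theta)
  (fun w => mdist y0 (Ystar 1 w) `^ theta)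
  (fun w => mdist y0 (f (y0, X' 0 w, eps' 1 w)) `^ theta + r `^ theta)
  (rho `^ theta)).
- exact: mpow.
- exact: mpow.
- by apply: measurable_funD => //; exact: mpow.
- by move=> w; exact: powR_ge0.
- by move=> w; exact: powR_ge0.
- by move=> w; rewrite addr_ge0 ?powR_ge0.
- have [p0 p1] := andP rho01.
  have -> : 1 = 1 `^ theta :> R by rewrite powR1.
  by rewrite powR_ge0 gt0_ltr_powR ?nnegrE ?(ltW p0).
- have := solution_recursion solY 1; rewrite subrr.
  apply: filterS => w ->.
  set y := Ystar 0 w; set x := X' 0 w; set e := eps' 1 w.
  have cn : mdist (f (y0, x, e)) (f (y, x, e)) <= rho * mdist y0 y + r.
    by case: assA => _ _; apply.
  have tri := metric_triangle y0 (f (y0, x, e)) (f (y, x, e)).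
  have [p0 p1] := andP rho01.
  have q0 : 0 <= rho * mdist y0 y by rewrite mulr_ge0 ?mdist_ge0 ?ltW.
  apply: (@le_trans _ _ ((rho * mdist y0 y + (mdist y0 (f (y0, x, e)) + r)) `^ theta)).
    apply: ge0_ler_powR; rewrite ?nnegrE ?mdist_ge0 ?(ltW th0)//.
      by rewrite !addr_ge0 ?mdist_ge0// ltW.
    lra.
  apply: (le_trans (powR_subadditive q0 _ theta01)).
    by rewrite addr_ge0 ?mdist_ge0// ltW.
  rewrite powRM ?mdist_ge0 ?(ltW p0)// lerD2l.
  by apply: powR_subadditive => //; rewrite ?mdist_ge0// ltW.
- move=> B mB.
  have mC : measurable [set z : F * E | B (mdist y0 z.2 `^ theta)].
    have mg : measurable_fun [set: F * E] (fun z => mdist y0 z.2 `^ theta).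
      apply: (@measurableT_comp _ _ _ _ _ _ (fun x : R => x `^ theta)).
        exact: measurable_powR.
      by apply: (measurableT_comp (measurable_mdist y0)).
    by have := mg measurableT B mB; rewrite setTI.
  exact: (stationary_law 1 (solution_stationary solY) mC).
- under eq_integral do rewrite EFinD.
  rewrite ge0_integralD//.
  + rewrite integral_cst// lte_add_pinfty//.
    by rewrite measure_setT1 mule1 ltry.
  + by move=> w _; rewrite lee_fin powR_ge0.
  + by apply/measurable_EFinP; exact: mpow.
  + by move=> w _; rewrite lee_fin powR_ge0.
Qed.

Let beta := fail_exp P X eta.
Let pairs n w := (X n%:Z w, Y n w).
Let pair' w := (X' 0 w, Ystar 0 w).

Let meta : measurable_fun [set: F] eta. Proof. by case: assB. Qed.
Let eta01 x : 0 < eta x <= 1. Proof. by case: assB. Qed.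
Let minor y1 y2 : 0 < mdist y1 y2 <= near_dist rho r ->
  forall x y, y = y1 \/ y = y2 ->
  (forall A, measurable A ->
    ((eta x)%:E * nu (x, (y1, y2)) A <= L [set e | A (f (y, x, e))])%E) /\
  nu (x, (y1, y2)) (cball y K) = 1%E.
Proof. by case: assB => _ _ _ H dy x y yy; exact: H. Qed.

(** Both processes are compared with the chain started at [y0]. The mean of
    that chain, once integrated over the environment, depends on the law of the
    environment only, and is therefore the same for [X] and for [X']. *)
Lemma law_comparison l j N A : 2 * K + 4 * near_dist rho r <= radius rho r l ->
  measurable A ->
  `|fine (P (pairs (j + l.+1 * N) @^-1` A)) - fine (P' (pair' @^-1` A))| <=
  fine (P [set w | radius rho r j < mdist y0 (Y 0%N w)]) +
  fine (P' [set w | radius rho r j < mdist y0 (Ystar 0 w)]) + 2 * beta l N.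
Proof.
move=> rl mA; set n := (j + l.+1 * N)%N.
pose G (z : E * path_space F) : R := \1_A (z.2 n%:Z, z.1).
have mpair : measurable_fun [set: E * path_space F] (fun z => (z.2 n%:Z, z.1)).
  apply: measurable_fun_pair => //.
  by apply: (measurableT_comp (measurable_coord n%:Z)).
have uG : unit_fun G by exact: (unit_fun_comp (unit_fun_indic mA) mpair).
have mabs : measurable_fun [set: Om] (fun w => abs_path X w : path_space F).
  exact: (measurable_path (fun t => mX `|t|%N%:Z)).
have mabs' : measurable_fun [set: Om'] (fun w => abs_path X' w : path_space F).
  exact: (measurable_path (fun t => mX' `|t|%N%:Z)).
have fwd := @forgetting _ _ _ _ _ _ _ f L mf _ _ P (fun w => abs_path X w : path_space F) Y eps
  mabs mY meps (fun k => aeW _ (recY k)) law_e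
  (recursion_noise mf mX iid_eps indep_X_eps mY0 recY indep_Y0)
  rho r nu eta K assA meta eta01 minor l rl G j N y0 uG.
have rec' k : {ae P', forall w, Ystar k.+1%:Z w =
    f (Ystar k%:Z w, (abs_path X' w : path_space F) k%:Z, eps' k.+1%:Z w)}.
  have := solution_recursion solY k.+1%:Z.
  by rewrite (_ : k.+1%:Z - 1 = k%:Z)// -addn1 PoszD addrK.
have noise' k (S : set (E * path_space F)) B : measurable S -> measurable B ->
    P' ((fun w => (Ystar k%:Z w, abs_path X' w : path_space F)) @^-1` S `&` eps' k.+1%:Z @^-1` B) =
    (P' ((fun w => (Ystar k%:Z w, abs_path X' w : path_space F)) @^-1` S) *
     P' (eps' k.+1%:Z @^-1` B))%E.
  have -> : k.+1%:Z = k%:Z + 1 by rewrite -addn1 PoszD.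
  exact: (nonanticipative_noise (solution_nonanticipative solY (t:=k%:Z))).
have bwd := @forgetting _ _ _ _ _ _ _ f L mf _ _ P' (fun w => abs_path X' w : path_space F)
  (fun k => Ystar k%:Z) (fun k => eps' k%:Z)
  mabs' (fun k => mYs k%:Z) (fun k => meps' k%:Z) rec' (fun k => @law_e' k%:Z) noise'
  rho r nu eta K assA meta eta01 minor l rl G j N y0 uG.
have failP : \int[P]_w fail_prod eta l (abs_path X w) j N = beta l N.
  exact: (fail_shift mX statX l meta eta01 j N).
have failP' : \int[P']_w fail_prod eta l (abs_path X' w) j N = beta l N.
  rewrite -failP.
  exact: (same_law_Rintegral mX' mX lawX' (fail_prod_unit meta eta01 l j N)).
have start : \int[P']_w path_exp f L G 0 n (y0, abs_path X' w) =
    \int[P]_w path_exp f L G 0 n (y0, abs_path X w).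
  have mm : measurable_fun [set: path_space F]
      (fun x : path_space F => (y0, (fun t => x `|t|%N%:Z) : path_space F)).
    apply: measurable_fun_pair => //.
    by apply: (@measurable_path _ _ _ _ (fun t (x : path_space F) => x `|t|%N%:Z)) => t; exact: measurable_coord.
  exact: (same_law_Rintegral mX' mX lawX' (unit_fun_comp (path_exp_unit L mf 0 n uG) mm)).
have PE : \int[P]_w G (Y n w, abs_path X w) = fine (P (pairs n @^-1` A)).
  rewrite -Rintegral_indic//.
  by rewrite -[X in measurable X]setTI; apply: measurable_fun_pair.
have PE' : \int[P']_w G (Ystar n%:Z w, abs_path X' w) = fine (P' (pair' @^-1` A)).
  have mp t : measurable_fun [set: Om'] (fun w => (X' t w, Ystar t w)).
    exact: measurable_fun_pair.
  rewrite (stationary_law n%:Z (solution_stationary solY) mA) -Rintegral_indic//.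
  by rewrite -[X in measurable X]setTI; apply: mp.
move: fwd bwd; rewrite -/n PE PE' failP failP' start !ler_norml; lra.
Qed.

Let c0 := theta * - ln ((1 + rho) / 2) / 2.

Lemma c0_gt0 : 0 < c0.
Proof.
rewrite /c0 divr_gt0// mulr_gt0// oppr_gt0 ln_lt0//.
by have := rho01; lra.
Qed.

(** At least half of the time is spent on bringing initial states near [y0], the
    rest on the attempts, one every [l.+1] steps. *)
Lemma dTV_comparison l : 2 * K + 4 * near_dist rho r <= radius rho r l ->
  exists2 C, 0 <= C & forall n,
    dTV (pushforward P (pairs n)) (pushforward P' pair') <=
    C * expR (- (c0 * n%:R)) + 2 * beta l (n %/ (2 * l.+1)).
Proof.
move=> rl.
have m1 : measurable_fun [set: Om] (fun w => mdist y0 (Y 0%N w)).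
  exact: (measurableT_comp (measurable_mdist y0)).
have m2 : measurable_fun [set: Om'] (fun w => mdist y0 (Ystar 0 w)).
  exact: (measurableT_comp (measurable_mdist y0)).
have mom : (\int[P]_w (mdist y0 (Y 0%N w) `^ theta)%:E < +oo)%E.
  by move: moment_Y0; rewrite unlock.
have [C1 C10 H1] := radius_tail r0 rho01 th0 m1 (fun w => mdist_ge0 _ _) mom.
have [C2 C20 H2] := radius_tail r0 rho01 th0 m2 (fun w => mdist_ge0 _ _) stationary_solution_moment.
exists (C1 + C2); first exact: addr_ge0.
move=> n; set N := (n %/ (2 * l.+1))%N.
have lN : (2 * (l.+1 * N) <= n)%N by rewrite mulnA mulnC leq_divM.
pose j := (n - l.+1 * N)%N.
have lN1 : (l.+1 * N <= n)%N by apply: leq_trans lN; rewrite leq_pmull.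
have nE : n = (j + l.+1 * N)%N by rewrite subnK.
have nj : (n <= 2 * j)%N by rewrite mulnBr leq_subRL ?(mul2n n) -?addnn ?leq_add2r// (leq_trans lN)// leq_addr.
have mp : measurable_fun [set: Om] (pairs n) by exact: measurable_fun_pair.
have mp' : measurable_fun [set: Om'] pair' by exact: measurable_fun_pair.
apply: (@dTV_le _ _ _ _ _ (law P mp) (law P' mp')) => // A mA.
have := law_comparison j N rl mA; rewrite -nE => /(le_trans (ler_norm _)) /le_trans; apply.
by have := H1 j n nj; have := H2 j n nj; rewrite /c0; lra.
Qed.

End comparison.

(** * Rates of convergence *)
Section transfer.
Context {R : realType}.
Variables (D u : nat -> R) (C c0 : R) (b : nat).
Hypothesis D_ge0 : forall n, 0 <= D n.
Hypothesis C_ge0 : 0 <= C.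
Hypothesis c0_gt0 : 0 < c0.
Hypothesis D_le : forall n, D n <= C * expR (- (c0 * n%:R)) + 2 * u (n %/ b).

Lemma bigO_transfer (g : nat -> R) (C1 : R) (n1 : nat) :
  (forall n, (n1 <= n)%N ->
    expR (- (c0 * n%:R)) <= g n /\ u (n %/ b) <= C1 * g n) ->
  D =O_\oo g.
Proof.
move=> H; apply: (@bigO_intro _ _ _ (C + 2 * C1) n1) => n /H[Hg Hu].
rewrite ger0_norm ?D_ge0// ger0_norm; last exact: le_trans (expR_ge0 _) Hg.
by apply: (le_trans (D_le n)); rewrite [leRHS]mulrDl -mulrA lerD// ler_wpM2l.
Qed.

(** The failure sequence decreases like [exp (- c n / log n)], and the
    iterated logarithm in the claim is at least [1] for large [n]. *)
Lemma transfer_geometric : (exists c n0, 0 < c /\ forall n, (n0 <= n)%N ->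
    u (n %/ b) <= expR (- (c * n%:R / log2 n%:R))) ->
  exists2 c, 0 < c &
    D =O_\oo (fun n => expR (- (c * n%:R / (log2 n%:R * log2 (log2 n%:R))))).
Proof.
move=> [c [n0 [c1 H]]].
exists (Num.min c c0); first by rewrite lt_min c1.
have [n2 H2] := @ln_large R (2 * ln 2).
apply: (@bigO_transfer _ 1 (maxn n0 n2)) => n; rewrite geq_max => /andP[nn0 nn2].
have l2 : 0 < ln 2 :> R by rewrite ln_gt0// ltr1n.
have L2 : 2 <= log2 n%:R :> R by rewrite /log2 ler_pdivlMr// H2.
have L0 : 0 < log2 n%:R :> R by lra.
have LL1 : 1 <= log2 (log2 n%:R) :> R.
  by rewrite /log2 ler_pdivlMr// mul1r -/(log2 _) ler_ln ?posrE.
set L := log2 n%:R in L2 L0 LL1 *; set LL := log2 L in LL1 *.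
have LL0 : 0 < LL by lra.
have key (k : R) : 0 <= k -> k / (L * LL) <= k / L.
  move=> k0; apply: ler_wpM2l => //.
  have LLL : 0 < L * LL by exact: mulr_gt0.
  by rewrite lef_pV2 ?posrE//; apply: ler_peMr => //; exact: ltW.
have c'0 : 0 <= Num.min c c0 * n%:R by rewrite mulr_ge0// le_min !ltW.
split; rewrite ?mul1r.
  rewrite ler_expR lerN2; apply: (le_trans (key _ c'0)).
  rewrite ler_pdivrMr//; apply: (@le_trans _ _ (c0 * n%:R)).
    by rewrite ler_wpM2r// ge_min lexx orbT.
  by apply: ler_peMr; [rewrite mulr_ge0 ?(ltW c0_gt0)|lra].
apply: (le_trans (H n nn0)); rewrite ler_expR lerN2; apply: (le_trans (key _ c'0)).
by rewrite ler_wpM2r ?invr_ge0 ?(ltW L0)// ler_wpM2r// ge_min lexx.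
Qed.

Lemma transfer_stretched gamma : 0 < gamma < 1 ->
  (exists c n0, 0 < c /\ forall n, (n0 <= n)%N ->
    u (n %/ b) <= expR (- (c * n%:R `^ gamma))) ->
  exists2 c, 0 < c & D =O_\oo (fun n => expR (- (c * n%:R `^ gamma))).
Proof.
move=> /andP[g0 g1] [c [n0 [c1 H]]].
exists (Num.min c c0); first by rewrite lt_min c1.
apply: (@bigO_transfer _ 1 (maxn n0 1)) => n; rewrite geq_max => /andP[nn0 n1].
split; rewrite ?mul1r.
  rewrite ler_expR lerN2; apply: ler_pM; rewrite ?powR_ge0 ?le_min ?(ltW c1) ?(ltW c0_gt0)//.
    by rewrite ge_min lexx orbT.
  by rewrite -[leRHS]powRr1// ler_powR ?ler1n// ltW.
apply: (le_trans (H n nn0)); rewrite ler_expR lerN2 ler_wpM2r ?powR_ge0//.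
by rewrite ge_min lexx.
Qed.

Lemma transfer_polynomial gamma : 0 < gamma ->
  (exists C' n0, 0 < C' /\ forall n, (n0 <= n)%N ->
    u (n %/ b) <= C' * (log2 n%:R `^ gamma / n%:R `^ gamma)) ->
  D =O_\oo (fun n => log2 n%:R `^ gamma / n%:R `^ gamma).
Proof.
move=> g0 [C' [n0 [C'0 H]]].
have [n2 H2] := @log_small R (gamma / c0).
apply: (@bigO_transfer _ C' (maxn n0 (maxn n2 2))) => n.
rewrite !geq_max => /and3P[nn0 nn2 n2']; split; last exact: H.
have n_gt0 : 0 < n%:R :> R by rewrite ltr0n (leq_trans _ n2').
have l2 : 0 < ln 2 :> R by rewrite ln_gt0// ltr1n.
have L1 : 1 <= log2 n%:R :> R.
  by rewrite /log2 ler_pdivlMr// mul1r ler_ln ?posrE// ler_nat.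
apply: (@le_trans _ _ (n%:R `^ gamma)^-1); last first.
  rewrite ler_peMl ?invr_ge0 ?powR_ge0//.
  rewrite -[leLHS](congr1 (@^~ gamma) (powR1 R)).
  by apply: ge0_ler_powR; rewrite ?nnegrE ?(ltW g0)//; lra.
rewrite -powRN /powR gt_eqF// ler_expR mulNr lerN2.
by have := H2 n nn2; rewrite mulrAC ler_pdivrMr// [n%:R * _]mulrC.
Qed.

Lemma transfer_exponential : (exists c C', [/\ 0 < c, 0 < C' &
    forall n, u (n %/ b) <= C' * expR (- (c * n%:R))]) ->
  exists2 c, 0 < c & D =O_\oo (fun n => expR (- (c * n%:R))).
Proof.
move=> [c [C' [c1 C'0 H]]].
exists (Num.min c c0); first by rewrite lt_min c1.
apply: (@bigO_transfer _ C' 0%N) => n _; split.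
  by rewrite ler_expR lerN2 ler_wpM2r// ge_min lexx orbT.
apply: (le_trans (H n)); rewrite ler_wpM2l ?(ltW C'0)//.
by rewrite ler_expR lerN2 ler_wpM2r// ge_min lexx.
Qed.

End transfer.

Theorem theorem2p7 (R : realType) (dE dF : measure_display)
  (E : polishType dE R) (F : polishType dF R)
  (m : nat) (m_gt0 : (0 < m)%N)
  (f : E * F * m.-tuple R -> E) (mf : measurable_fun [set: _] f)
  (* the driving processes X and eps *)
  (d : measure_display) (Om : measurableType d) (P : probability Om R)
  (X : int -> Om -> F) (mX : forall t, measurable_fun [set: Om] (X t))
  (statX : stationary P X)
  (eps : nat -> Om -> m.-tuple R) (iid_eps : iid P eps)
  (indep_X_eps :
    independent_sigma P (sigma_gen [set: int] X) (sigma_gen [set: nat] eps))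
  (* contractivity modulo a constant and minorization *)
  (rho r : R) (assA : contractive_modulo f rho r)
  (nu : R.-pker (F * (E * E)) ~> E) (eta : F -> R) (K : R)
  (assB : minorization P f (eps 0%N) rho r nu eta K)
  (* moment condition and the recursion started at Y 0 *)
  (y0 : E) (theta : R) (theta01 : 0 < theta <= 1)
  (moment_f :
    ('E_P[(fun w => mdist y0 (f (y0, X 0 w, eps 1%N w)) `^ theta)%R] < +oo)%E)
  (Y : nat -> Om -> E) (mY0 : measurable_fun [set: Om] (Y 0%N))
  (recY : forall n w, Y n.+1 w = f (Y n w, X n%:Z w, eps n.+1 w))
  (moment_Y0 : ('E_P[(fun w => mdist y0 (Y 0%N w) `^ theta)%R] < +oo)%E)
  (indep_Y0 :
    independent_sigma P (sigma_gen [set: unit] (fun _ => Y 0%N))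
      (sigma_gen [set: nat] (fun (t : nat) w => (X t%:Z w, eps t.+1 w))))
  (* a stationary solution, driven by two-sided versions of X and eps *)
  (d' : measure_display) (Om' : measurableType d') (P' : probability Om' R)
  (X' : int -> Om' -> F) (mX' : forall t, measurable_fun [set: Om'] (X' t))
  (lawX' : same_law P' X' P X)
  (eps' : int -> Om' -> m.-tuple R) (iid_eps' : iid P' eps')
  (law_eps' : same_law P' (fun n : nat => eps' n%:Z) P eps)
  (indep_X_eps' :
    independent_sigma P' (sigma_gen [set: int] X') (sigma_gen [set: int] eps'))
  (Ystar : int -> Om' -> E)
  (solY : stationary_solution P' f X' eps' Ystar) :
  let mu := pushforward P' (fun w => (X' 0 w, Ystar 0 w)) in
  let dist_to_mu (n : nat) :=
    dTV (pushforward P (fun w => (X n%:Z w, Y n w))) mu in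
  let alpha (n : nat) := alpha_mixing P X n in
  [/\ ('E_P'[(fun w => mdist y0 (Ystar 0 w) `^ theta)%R] < +oo)%E,
      (exists2 lambda : R, 0 < lambda < 1 &
        alpha =O_\oo (fun n : nat => lambda ^+ n)) ->
      exists2 c : R, 0 < c &
        dist_to_mu =O_\oo (fun n : nat =>
          expR (- (c * n%:R / (log2 n%:R * log2 (log2 n%:R))))),
      forall c gamma : R, 0 < c -> 0 < gamma < 1 ->
        alpha =O_\oo (fun n : nat => expR (- (c * n%:R `^ gamma))) ->
      exists2 c' : R, 0 < c' &
        dist_to_mu =O_\oo (fun n : nat => expR (- (c' * n%:R `^ gamma))),
      forall gamma : R, 0 < gamma ->
        alpha =O_\oo (fun n : nat => n%:R `^ (- gamma)) ->
        dist_to_mu =O_\oo (fun n : nat =>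
          log2 n%:R `^ gamma / n%:R `^ gamma)
    & (exists a : R, forall x, eta x = a) ->
      exists2 c : R, 0 < c &
        dist_to_mu =O_\oo (fun n : nat => expR (- (c * n%:R)))].
Proof.
move=> mu dist_to_mu alpha.
have [r0 rho01 _] := assA; have [meta eta01 _ _] := assB.
have [l rl] := contractive_reach (2 * K + 4 * near_dist rho r) r0 rho01.
have [C C0 D_le] := dTV_comparison mf mX statX iid_eps indep_X_eps assA assB
  theta01 moment_f mY0 recY moment_Y0 indep_Y0 mX' lawX' iid_eps' law_eps'
  indep_X_eps' solY rl.
have c0 := c0_gt0 assA theta01.
have D_ge0 n : 0 <= dist_to_mu n by exact: dTV_ge0.
have b0 : (0 < 2 * l.+1)%N by [].
have u0 := fail_exp_ge0 P mX l meta eta01.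
have u_decr := fail_exp_decr P mX l meta eta01.
have u_rec := fail_exp_rec mX statX l meta eta01.
have u_le1 := fail_exp_le1 P mX l meta eta01.
have u1 := fail_exp1 P mX l meta eta01.
have alpha0 n : 0 <= alpha n by exact: alpha_mixing_ge0.
split.
- rewrite unlock.
  exact: (stationary_solution_moment mf mX iid_eps indep_X_eps assA theta01
    moment_f mX' lawX' iid_eps' law_eps' indep_X_eps' solY).
- move=> [lambda l01 /bigO_ex[C1 [n1 [_ alphaO]]]].
  apply: (@transfer_geometric _ dist_to_mu (fail_exp P X eta l) C _ _ D_ge0 C0 c0 D_le).
  apply: (rate_geometric u0 u_decr u_rec u_le1 u1 alpha0 l01 b0) => n n1n.
  have := alphaO n n1n; rewrite ger0_norm// ger0_norm; first by apply.
  by rewrite exprn_ge0//; case/andP: l01 => /ltW.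
- move=> c gamma cp g01 /bigO_ex[C1 [n1 [_ alphaO]]].
  apply: (@transfer_stretched _ dist_to_mu (fail_exp P X eta l) C _ _ D_ge0 C0 c0 D_le _ g01).
  apply: (rate_stretched u0 u_decr u_rec u_le1 u1 alpha0 cp g01 b0) => n n1n.
  by have := alphaO n n1n; rewrite ger0_norm// ger0_norm ?expR_ge0//; apply.
- move=> gamma g0 /bigO_ex[C1 [n1 [_ alphaO]]].
  apply: (@transfer_polynomial _ dist_to_mu (fail_exp P X eta l) C _ _ D_ge0 C0 c0 D_le _ g0).
  apply: (rate_polynomial u0 u_decr u_rec u_le1 u1 alpha0 g0 b0) => n n1n.
  by have := alphaO n n1n; rewrite ger0_norm// ger0_norm ?powR_ge0//; apply.
- move=> [a etaE]; apply: (@transfer_exponential _ dist_to_mu (fail_exp P X eta l) C _ _ D_ge0 C0 c0 D_le).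
  have a01 : 0 <= 1 - a < 1 by have := eta01 point; rewrite etaE; lra.
  apply: (rate_exponential b0 a01) => n.
  rewrite /fail_exp /fail_prod; under eq_Rintegral do under eq_bigr do rewrite etaE.
  by rewrite Rintegral_cst1 prodr_const card_ord.
Qed.
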